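(* For $l\in\mathbb{N}$, let $\varrho(l)=(r_n^l)_{n\in\mathbb{N}}$ be increasing sequences in $(0,1)$ such that $r_n^l\to1$ as $n\to\infty$. Assume that for any $l\neq l'$, $\{r_n^l:n\in\mathbb{N}\}\cap\{r_n^{l'}:n\in\mathbb{N}\}=\emptyset$. Then $$\bigcap_{l\in\mathbb{N}}\mathcal{FU}_A(\mathbb{D},\varrho(l))\neq\emptyset.$$
   Context: $\mathbb{N}=\{0,1,2,\dots\}$, $\mathbb{D}$ is the open unit disc of $\mathbb{C}$, $\mathbb{T}$ the unit circle, $H(\mathbb{D})$ the space of holomorphic functions on $\mathbb{D}$, $\mathcal{C}(K)$ the space of continuous complex functions on a compact set $K$ with the uniform norm. ''Increasing'' means strictly increasing. For $E\subset\mathbb{N}$, the lower density is $\underline{d}(E)=\liminf_{n\to\infty}\frac{|E\cap\{1,\dots,n\}|}{n}$. For a sequence $\varrho=(r_n)_n$ in $[0,1)$ tending to $1$, $\mathcal{FU}_A(\mathbb{D},\varrho)$ is the set of $f\in H(\mathbb{D})$ such that for every compact $K\subset\mathbb{T}$ with $K\neq\mathbb{T}$ and every non-empty open $V\subset\mathcal{C}(K)$ in a fixed countable base of the topology of $\mathcal{C}(K)$, the set $\{n\in\mathbb{N}:(\zeta\mapsto f(r_n\zeta))|_K\in V\}$ has positive lower density. *)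

(* Defs.v *)
From HB Require Import structures.
From mathcomp Require Import all_boot all_order all_algebra finmap.
From mathcomp Require Import all_classical all_reals all_analysis.
From mathcomp Require Import complex.

Set Implicit Arguments.
Unset Strict Implicit.
Unset Printing Implicit Defensive.

Import Order.TTheory GRing.Theory Num.Theory.
Import numFieldNormedType.Exports.
(* gives [continuousType X Y] the topology of uniform convergence *)
Import ArrowAsUniformType.

Local Open Scope classical_set_scope.
Local Open Scope ring_scope.

(* The alias ^o carries the usual topology of R[i] and its structure of normed
   module over itself. Norms are valued in R[i]: `|z| is the modulus of z,
   embedded in R[i], and x < y there means that y - x is a positive real. *)
Notation Cplx R := (R[i]^o)%type (only parsing).

Definition unit_disc (R : realType) : set (Cplx R) := [set z | `|z| < 1].

Definition unit_circle (R : realType) : set (Cplx R) := [set z | `|z| = 1].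

(* The scalars are R[i], so [derivable] in the direction 1 is complex
   differentiability. The values of f outside the disc are irrelevant. *)
Definition holomorphic_disc (R : realType) (f : Cplx R -> Cplx R) : Prop :=
  forall z, unit_disc z -> derivable f z 1.

Definition Cont (R : realType) (K : set (Cplx R)) : uniformType :=
  continuousType (set_type K) (Cplx R).

Definition proper_compact (R : realType) (K : set (Cplx R)) : Prop :=
  [/\ compact K, K `<=` @unit_circle R & K <> @unit_circle R].

(* The term n = 0 is 0 / 0 = 0; it does not affect the limit inferior. *)
Definition lower_density (R : realType) (E : set nat) : \bar R :=
  limn_einf (fun n : nat =>
    ((#|` fset_set (E `&` [set k | (1 <= k <= n)%N])|)%:R / n%:R : R)%:E).

(* The base of C(K) is fixed arbitrarily for each K. *)
Definition countable_bases (R : realType)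
    (B : forall K : set (Cplx R), set (set (Cont K))) : Prop :=
  forall K : set (Cplx R), proper_compact K -> countable (B K) /\ basis (B K).

(* g is the restriction of z |-> f (r_n z) to K, as an element of C(K) *)
Definition visits (R : realType) (f : Cplx R -> Cplx R) (r : nat -> R)
    (K : set (Cplx R)) (V : set (Cont K)) : set nat :=
  [set n | exists2 g : continuousType (set_type K) (Cplx R), V g &
     forall z : set_type K, g z = f ((r n)%:C%C * \val z)].

Definition FUA (R : realType)
    (B : forall K : set (Cplx R), set (set (Cont K))) (r : nat -> R) :
    set (Cplx R -> Cplx R) :=
  [set f | holomorphic_disc f /\
     forall K, proper_compact K ->
     forall V : set (Cont K), B K V -> V !=set0 ->
       (0 < lower_density R (visits f r V))%E].

(* Main.v *)
Require Import Defs.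
From HB Require Import structures.
From mathcomp Require Import all_boot all_order all_algebra finmap.
From mathcomp Require Import all_classical all_reals all_analysis.
From mathcomp Require Import complex.
From mathcomp Require Import cyclic separable cyclotomic.
From mathcomp Require Import ring lra zify.

Set Implicit Arguments.
Unset Strict Implicit.
Unset Printing Implicit Defensive.

Import Order.TTheory GRing.Theory Num.Theory.
Import numFieldNormedType.Exports.

Local Open Scope classical_set_scope.
Local Open Scope ring_scope.

(** The only property of the members of the base that matters is that they are
    open.

    Countably many targets suffice. A proper compact part [K] of the circle lies
    in an arc: the circle deprived of a disc with rational data. On such an arc
    the closed algebra generated by the polynomials contains [z^-1], which is the
    conjugate of [z], hence all the continuous functions
    ([appr_continuous]); and the coefficients of the polynomials may be taken in
    the Gaussian rationals ([rat_poly_dense], [datum_dense]).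

    The function is [f = \sum_k P_k], where [P_k] is at most [2 ^- k] on the disc
    of radius [1 - 2 ^- k.+1]. The index [k] takes care of the finitely many radii
    [r l n] with [l <= k] that lie in the annulus between two consecutive discs.
    Since all the radii are distinct, each of them can be assigned one target:
    the one encoded by the 2-adic valuation of [n]. [P_k] is chosen such that
    [P_0 + ... + P_k] is within [2 ^- k] of the assigned targets on the dilated
    arcs ([stage]); the rest of the series does not spoil this
    ([universal_function]). A given target is then approximated, with an error
    tending to [0], along all the [n] of a given valuation, and these form an
    arithmetic progression, whose lower density is positive
    ([lower_density_progression]).

    The choice of [P_k] is an instance of Runge's theorem: a polynomial can be
    small on a disc and close to a given polynomial [h] on an arc of a larger
    circle ([runge_arc]). It is enough to find a polynomial close to [0] on the
    disc and to [1] on the arc ([separator]), and to multiply it by [h]. The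
    function [z ^ N / (z ^ N + rho ^ N)], where [rho] lies between the two radii,
    does this, except that it has poles on the circle of radius [rho]. The
    function [(z - a)^-1] is a uniform limit of polynomials when [a] is far away,
    by the geometric series, and remains so when [a] moves without meeting the
    disc and the arc ([appr_pole_push]): [a] comes from infinity through the gap
    of the arc ([appr_pole_ray]), then turns around the disc
    ([appr_pole_circle]).

    That [f] is holomorphic follows from second order Taylor estimates for
    polynomials in terms of their supremum on a larger disc ([taylor2]), which
    are stable under summation ([series_taylor]); the factor theorem and
    Cauchy's bounds on the coefficients give them. *)

(** * The modulus *)

Section Modulus.
Variable R : realType.
Local Notation C := R[i].
Implicit Types (x y z a b : C) (t : R).

(** The modulus of a complex number, as an element of [R] rather than as a real
    complex number. *)
Definition modc z : R := ComplexField.Normc.normc z.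

Lemma normE z : `|z| = (modc z)%:C%C. Proof. by []. Qed.
Lemma modc_ge0 z : 0 <= modc z.
Proof. by rewrite -ler0c -normE normr_ge0. Qed.
Lemma modcM x y : modc (x * y) = modc x * modc y.
Proof. exact: ComplexField.Normc.normcM. Qed.
Lemma modcV x : modc x^-1 = (modc x)^-1.
Proof. exact: ComplexField.Normc.normcV. Qed.
Lemma modc0 : modc 0 = 0. Proof. exact: ComplexField.Normc.normc0. Qed.
Lemma modc1 : modc 1 = 1. Proof. exact: ComplexField.Normc.normc1. Qed.
Lemma modcX x n : modc (x ^+ n) = modc x ^+ n.
Proof. by elim: n => [|n IH]; rewrite ?expr0 ?modc1 // !exprS modcM IH. Qed.
Lemma modcD x y : modc (x + y) <= modc x + modc y.
Proof. exact: le_normcD. Qed.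
Lemma modcN x : modc (- x) = modc x. Proof. exact: normcN. Qed.
Lemma modcB x y : modc (x - y) <= modc x + modc y.
Proof. by rewrite -(modcN y) modcD. Qed.
Lemma modcBC x y : modc (x - y) = modc (y - x).
Proof. by rewrite -modcN opprB. Qed.
Lemma modc_tri x y z : modc (x - z) <= modc (x - y) + modc (y - z).
Proof. by rewrite (_ : x - z = (x - y) + (y - z)) ?modcD // addrA subrK. Qed.
Lemma modc_subr x y : modc x - modc y <= modc (x - y).
Proof. by have := modcD (x - y) y; rewrite subrK lerBlDr. Qed.
Lemma modc_eq0 x : (modc x == 0) = (x == 0).
Proof.
apply/eqP/eqP => [/ComplexField.Normc.eq0_normc//|->]; exact: modc0.
Qed.
Lemma modc_gt0 x : (0 < modc x) = (x != 0).
Proof. by rewrite lt_neqAle modc_ge0 andbT eq_sym modc_eq0. Qed.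
Lemma modc_real t : modc t%:C%C = `|t|.
Proof. by rewrite /modc /= expr0n addr0 sqrtr_sqr. Qed.
Lemma modc_pos t : 0 <= t -> modc t%:C%C = t.
Proof. by move=> t0; rewrite modc_real ger0_norm. Qed.
Lemma modc_sum (I : Type) (s : seq I) (P : pred I) (F : I -> C) :
  modc (\sum_(i <- s | P i) F i) <= \sum_(i <- s | P i) modc (F i).
Proof.
elim/big_ind2 : _ => [|x1 x2 y1 y2 h1 h2|//]; first by rewrite modc0.
exact: le_trans (modcD _ _) (lerD h1 h2).
Qed.
Lemma modc_nat n : modc n%:R = n%:R.
Proof.
by rewrite -[n%:R in LHS](rmorph_nat (real_complex R)) modc_real ger0_norm.
Qed.
(** The parallelogram identity with one unit vector equal to [1]. *)
Lemma modc_parallel1 z :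
  modc (z + 1) ^+ 2 + modc (z - 1) ^+ 2 = 2 * modc z ^+ 2 + 2.
Proof.
case: z => a b; rewrite /modc /= !sqr_sqrtr ?addr_ge0 ?sqr_ge0 //.
by rewrite subr0 addr0; ring.
Qed.

End Modulus.

(** * Uniform limits of polynomials *)

Section Approximation.
Variable R : realType.
Local Notation C := R[i].
Implicit Types (x y z a b : C) (L : set C) (u v : C -> C) (p q : {poly C}).

Lemma exprn_small (q eps : R) : 0 <= q < 1 -> 0 < eps ->
  exists n, q ^+ n <= eps.
Proof.
move=> /andP[q0 q1] e0.
have h : (fun n => q ^+ n) @ \oo --> (0 : R) by apply: cvg_expr; rewrite ger0_norm.
move/cvgrPdist_le: h => /(_ _ e0)[N _ /(_ N (leqnn N))] /=.
by rewrite sub0r normrN ger0_norm ?exprn_ge0 // => ?; exists N.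
Qed.

(** [appr L u]: on [L], the function [u] is a uniform limit of polynomials. *)
Definition appr L u := forall eps : R, 0 < eps ->
  exists p, forall z, L z -> modc (p.[z] - u z) <= eps.

Lemma poly_bounded p :
  exists2 M : R, 0 < M & forall z, modc z <= 1 -> modc p.[z] <= M.
Proof.
exists (\sum_(i < size p) modc p`_i + 1).
  by rewrite ltr_wpDl // sumr_ge0 // => i _; exact: modc_ge0.
move=> z z1; rewrite horner_coef.
apply: le_trans (modc_sum _ _ _) _; rewrite ler_wpDr //.
apply: ler_sum => i _; rewrite modcM modcX ler_piMr ?modc_ge0 //.
by rewrite exprn_ile1 ?modc_ge0.
Qed.

Lemma appr_poly L p : appr L (horner p).
Proof. by move=> e e0; exists p => z _; rewrite subrr modc0 ltW. Qed.

Lemma appr_ext L u v : (forall z, L z -> u z = v z) -> appr L u -> appr L v.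
Proof.
by move=> uv h e /h[p hp]; exists p => z Lz; rewrite -uv //; exact: hp.
Qed.

Lemma appr_lim L u :
  (forall eps : R, 0 < eps -> exists2 v, appr L v &
     forall z, L z -> modc (v z - u z) <= eps) -> appr L u.
Proof.
move=> h e e0; have [v hv vu] := h (e / 2) ltac:(lra).
have [p pv] := hv (e / 2) ltac:(lra).
exists p => z Lz; apply: le_trans (modc_tri _ (v z) _) _.
by have := vu z Lz; have := pv z Lz; lra.
Qed.

Lemma apprD L u v : appr L u -> appr L v -> appr L (fun z => u z + v z).
Proof.
move=> hu hv e e0; have [p pu] := hu (e / 2) ltac:(lra).
have [q qv] := hv (e / 2) ltac:(lra).
exists (p + q) => z Lz; rewrite hornerD opprD addrACA.
apply: le_trans (modcD _ _) _.
by have := pu z Lz; have := qv z Lz; lra.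
Qed.

Lemma appr_cst L a : appr L (fun=> a).
Proof. by apply: appr_ext (@appr_poly L a%:P) => z _; rewrite hornerC. Qed.

Lemma appr_id L : appr L id.
Proof. by apply: appr_ext (@appr_poly L 'X) => z _; rewrite hornerX. Qed.

Section InDisc.
Variable L : set C.
Hypothesis L1 : forall z, L z -> modc z <= 1.

Lemma appr_bounded u : appr L u ->
  exists2 M : R, 0 < M & forall z, L z -> modc (u z) <= M.
Proof.
move=> /(_ 1 ltr01)[p hp]; have [M M0 hM] := poly_bounded p.
exists (M + 1); first lra.
move=> z Lz; have := hM z (L1 Lz); have := hp z Lz.
by rewrite modcBC; have := modc_subr (u z) p.[z]; lra.
Qed.

Lemma apprM u v : appr L u -> appr L v -> appr L (fun z => u z * v z).
Proof.
move=> hu hv e e0; have [Mv Mv0 hMv] := appr_bounded hv.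
have [p hp] := hu (e / 2 / Mv) ltac:(by rewrite !divr_gt0).
have [Mp Mp0 hMp] := poly_bounded p.
have [q hq] := hv (e / 2 / Mp) ltac:(by rewrite !divr_gt0).
exists (p * q) => z Lz; rewrite hornerM.
have -> : p.[z] * q.[z] - u z * v z =
  p.[z] * (q.[z] - v z) + (p.[z] - u z) * v z by ring.
apply: le_trans (modcD _ _) _; rewrite !modcM [e]splitr lerD //.
  rewrite -[leRHS](@divfK _ Mp) ?gt_eqF // mulrC.
  by apply: ler_pM; rewrite ?modc_ge0 ?hq // hMp // L1.
rewrite -[leRHS](@divfK _ Mv) ?gt_eqF //.
by apply: ler_pM; rewrite ?modc_ge0 ?hp // hMv.
Qed.

Lemma apprZ a u : appr L u -> appr L (fun z => a * u z).
Proof. by move=> hu; apply: apprM hu; exact: appr_cst. Qed.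

Lemma apprX u n : appr L u -> appr L (fun z => u z ^+ n).
Proof.
move=> hu; elim: n => [|n IH].
  by apply: appr_ext (@appr_cst L 1) => z _; rewrite expr0.
by apply: appr_ext (apprM hu IH) => z _; rewrite exprS.
Qed.

Lemma appr_sum (I : Type) (s : seq I) (F : I -> C -> C) :
  (forall i, appr L (F i)) -> appr L (fun z => \sum_(i <- s) F i z).
Proof.
move=> hF; elim: s => [|i s IH].
  by apply: appr_ext (@appr_cst L 0) => z _; rewrite big_nil.
by apply: appr_ext (apprD (hF i) IH) => z _; rewrite big_cons.
Qed.

Lemma appr_prod (I : eqType) (s : seq I) (F : I -> C -> C) :
  (forall i, i \in s -> appr L (F i)) -> appr L (fun z => \prod_(i <- s) F i z).
Proof.
elim: s => [_|i s IH hF].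
  by apply: appr_ext (@appr_cst L 1) => z _; rewrite big_nil.
have h : appr L (fun z => \prod_(i <- s) F i z).
  by apply: IH => j js; apply: hF; rewrite inE js orbT.
by apply: appr_ext (apprM (hF i _) h); rewrite ?inE ?eqxx // => z _;
  rewrite big_cons.
Qed.

(** [(1 - u)^-1] is the sum of a geometric series of functions. This is the
    only source of inverses. *)
Lemma appr_geom u (q : R) : q < 1 -> appr L u ->
  (forall z, L z -> modc (u z) <= q) -> appr L (fun z => (1 - u z)^-1).
Proof.
move=> q1 hu uq; apply: appr_lim => e e0.
have [q0|q0] := ltP q 0.
  exists (fun=> 0); first exact: appr_cst.
  by move=> z /uq; have := modc_ge0 (u z); lra.
have [n hn] := @exprn_small q (e * (1 - q)) ltac:(lra)
  ltac:(by rewrite mulr_gt0 // subr_gt0).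
exists (fun z => \sum_(i < n) u z ^+ i).
  have h := @appr_sum nat (iota 0 n) (fun i z => u z ^+ i) (fun i => apprX i hu).
  apply: appr_ext h => z _.
  by rewrite -(big_mkord xpredT (fun i => u z ^+ i)) /index_iota subn0.
move=> z Lz; have hq := uq z Lz.
have m1 : 1 - q <= modc (1 - u z) by have := modc_subr 1 (u z); rewrite modc1; lra.
have nz : 1 - u z != 0 by rewrite -modc_gt0; lra.
have -> : \sum_(i < n) u z ^+ i - (1 - u z)^-1 = - (u z ^+ n / (1 - u z)).
  apply: (mulfI nz); rewrite mulrBr -[1 - u z]opprB mulNr -subrX1 opprB.
  by field.
rewrite modcN modcM modcV modcX ler_pdivrMr; last lra.
apply: le_trans (_ : q ^+ n <= _); first by rewrite lerXn2r ?nnegrE ?modc_ge0.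
by apply: le_trans hn _; rewrite ler_pM2l.
Qed.

End InDisc.
End Approximation.

(** * Pole pushing *)

Section PolePushing.
Variable R : realType.
Local Notation C := R[i].
Implicit Types (x y z a b w : C) (L : set C) (p q h : {poly C}).

Section InDisc.
Variable L : set C.
Hypothesis L1 : forall z, L z -> modc z <= 1.

Lemma appr_pole_far a : 2 <= modc a -> appr L (fun z => (z - a)^-1).
Proof.
move=> a2; have a0 : a != 0 by rewrite -modc_gt0; lra.
have hu : appr L (fun z => a^-1 * z) by apply: apprZ; [exact: L1|exact: appr_id].
have hq z : L z -> modc (a^-1 * z) <= 1 / 2.
  move=> /L1 z1; rewrite modcM modcV mulrC ler_pdivrMr; last lra.
  by have := modc_ge0 z; nra.
have h := apprZ L1 (- a^-1) (appr_geom L1 (q := 1 / 2) ltac:(lra) hu hq).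
apply: appr_ext h => z Lz.
have -> : z - a = - a * (1 - a^-1 * z) by field.
by rewrite invfM invrN.
Qed.

(** A pole can be moved by at most half of its distance to [L]: expand
    [(z - b)^-1] in powers of [(b - a) / (z - a)]. *)
Lemma appr_pole_push a b (d : R) : 0 < d ->
  (forall z, L z -> d <= modc (z - a)) -> modc (b - a) <= d / 2 ->
  appr L (fun z => (z - a)^-1) -> appr L (fun z => (z - b)^-1).
Proof.
move=> d0 da ba ha; have hu := apprZ L1 (b - a) ha.
have hq z : L z -> modc ((b - a) * (z - a)^-1) <= 1 / 2.
  move=> /da z1; rewrite modcM modcV ler_pdivrMr; last lra.
  by lra.
have h := apprM L1 ha (appr_geom L1 (q := 1 / 2) ltac:(lra) hu hq).
apply: appr_ext h => z Lz.
have za : z - a != 0 by rewrite -modc_gt0; have := da z Lz; lra.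
have zb : z - b != 0.
  rewrite -modc_gt0; have := da z Lz; have := modc_tri z b a; lra.
by rewrite -invfM mulrBr mulr1 mulrCA divff // mulr1; congr (_^-1); ring.
Qed.

(** Poles are brought from infinity along the half line of direction [w], up to
    the point of abscissa [rho]. *)
Lemma appr_pole_ray w (rho d : R) : modc w = 1 -> 0 < d ->
  (forall x : R, rho <= x -> forall z, L z -> d <= modc (z - x%:C%C * w)) ->
  appr L (fun z => (z - rho%:C%C * w)^-1).
Proof.
move=> w1 d0 hd.
(* Induction on the number of steps of length d / 2 starting beyond abscissa 2. *)
have step k : forall x : R, rho <= x -> 2 - k%:R * (d / 2) <= x ->
    appr L (fun z => (z - x%:C%C * w)^-1).
  elim: k => [|k IH] x rx kx.
    apply: appr_pole_far; rewrite modcM w1 mulr1 modc_real.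
    by apply: le_trans (ler_norm _); lra.
  apply: (@appr_pole_push ((x + d / 2)%:C%C * w) _ d) => //.
  - by apply: hd; lra.
  - rewrite -mulrBl modcM w1 mulr1 -rmorphB modc_real opprD addNKr normrN.
    by rewrite ger0_norm //; lra.
  - by apply: IH; [lra|move: kx; rewrite -natr1; lra].
have [k hk] : exists k : nat, (2 - rho) / (d / 2) <= k%:R.
  exists (Num.bound `|(2 - rho) / (d / 2)|); apply: le_trans (ler_norm _) _.
  by rewrite ltW // archi_boundP.
apply: (step k) => //; move: hk; rewrite ler_pdivrMr; lra.
Qed.

End InDisc.

(** One of the two square roots of a unit number is closer to [1], by a fixed
    factor: the one that is far from [-1]. *)
Lemma sqrt_near_1 v : modc v = 1 -> exists w,
  [/\ w ^+ 2 = v, modc w = 1 & modc (w - 1) <= 4 / 5 * modc (v - 1)].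
Proof.
move=> v1; have [w [w2 wD]] : exists w, w ^+ 2 = v /\ 5 / 4 <= modc (w + 1).
  have s2 := sqr_sqrtc v; set w := sqrtc v in s2.
  have w1 : modc w = 1.
    apply/eqP; rewrite -(@eqrXn2 _ 2) ?modc_ge0 //.
    by rewrite expr1n -modcX s2 v1.
  have := modc_parallel1 w; rewrite w1 => par.
  have [hw|hw] := leP (5 / 4) (modc (w + 1)); first by exists w.
  exists (- w); rewrite sqrrN; split=> //.
  rewrite addrC modcBC; have := modc_ge0 (w - 1); have := modc_ge0 (w + 1); nra.
exists w; split=> //.
  apply/eqP; rewrite -(@eqrXn2 _ 2) ?modc_ge0 //.
  by rewrite expr1n -modcX w2 v1.
have -> : v - 1 = (w - 1) * (w + 1) by rewrite -w2; ring.
by rewrite modcM; have := modc_ge0 (w - 1); nra.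
Qed.

(** The unit circle is generated, as a group, by any neighbourhood of [1]:
    iterated square roots bring any unit number close to [1]. *)
Lemma circle_generated (S : set C) (eta : R) : 0 < eta ->
  (forall v, modc v = 1 -> modc (v - 1) <= eta -> forall a, S a -> S (v * a)) ->
  forall v, modc v = 1 -> forall a, S a -> S (v * a).
Proof.
move=> e0 hS.
have step k : forall v, modc v = 1 -> (4 / 5) ^+ k * modc (v - 1) <= eta ->
    forall a, S a -> S (v * a).
  elim: k => [|k IH] v v1; first by rewrite mul1r; exact: hS.
  have [w [<- w1 wv]] := sqrt_near_1 v1 => hv a Sa.
  have hw : (4 / 5) ^+ k * modc (w - 1) <= eta.
    apply: le_trans hv; rewrite exprSr -mulrA ler_wpM2l ?exprn_ge0 //; lra.
  by rewrite expr2 -mulrA; exact: IH (IH _ w1 hw _ Sa).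
move=> v v1; have [k hk] := @exprn_small R (4 / 5) (eta / 2) ltac:(lra) ltac:(lra).
apply: (step k) => //; have := modcB v 1; rewrite v1 modc1 => v2.
have p0 : 0 <= ((4 / 5) ^+ k : R) by rewrite exprn_ge0 //; lra.
by nra.
Qed.

(** A pole can be moved along a circle that avoids [L]. *)
Lemma appr_pole_circle L (rho d : R) a0 a :
  (forall z, L z -> modc z <= 1) -> 0 < rho -> 0 < d ->
  (forall b, modc b = rho -> forall z, L z -> d <= modc (z - b)) ->
  appr L (fun z => (z - a0)^-1) -> modc a0 = rho -> modc a = rho ->
  appr L (fun z => (z - a)^-1).
Proof.
move=> L1 r0 d0 hd h0 m0 ma.
pose S b := modc b = rho /\ appr L (fun z => (z - b)^-1).
have a00 : a0 != 0 by rewrite -modc_gt0 m0.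
have v1 : modc (a / a0) = 1 by rewrite modcM modcV m0 ma divff ?gt_eqF.
suff [] : S ((a / a0) * a0) by rewrite divfK.
apply: (@circle_generated S (d / 2 / rho)) v1 _ _ => //.
  by rewrite !divr_gt0.
move=> v v1 vd b [mb hb]; split; first by rewrite modcM v1 mul1r.
apply: (appr_pole_push L1 d0 (hd b mb)) hb.
by rewrite -{2}[b]mul1r -mulrBl modcM mb -ler_pdivlMr.
Qed.

End PolePushing.

(** * Runge's theorem for a disc and arcs *)

Section Arcs.
Variable R : realType.
Local Notation C := R[i].
Implicit Types (x y z a b w : C) (L : set C) (p q h P Q : {poly C}).

(** The unit circle deprived of an open disc centred at [w], of radius [eta]. *)
Definition arc w (eta : R) : set C :=
  [set z | modc z = 1 /\ eta <= modc (z - w)].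

(** When [w] is on the unit circle, its half line stays away from the dilated
    arc. *)
Lemma arc_ray w (eta t x : R) z : modc w = 1 -> 0 <= t -> 0 <= x ->
  arc w eta z -> t * eta / 2 <= modc (t%:C%C * z - x%:C%C * w).
Proof.
move=> w1 t0 x0 [z1 zw].
have h1 := modc_subr (t%:C%C * z) (x%:C%C * w).
have h2 := modc_subr (x%:C%C * w) (t%:C%C * z).
have h3 := modc_tri (t%:C%C * z) (x%:C%C * w) (t%:C%C * w).
rewrite modcBC in h2; rewrite -!mulrBr -mulrBl -rmorphB in h3.
have mt : modc (t%:C%C * z) = t by rewrite modcM z1 mulr1 modc_pos.
have mx : modc (x%:C%C * w) = x by rewrite modcM w1 mulr1 modc_pos.
rewrite {}mt {}mx in h1 h2.
rewrite [modc (_ * (z - w))]modcM [modc (_ * w)]modcM w1 mulr1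
  (modc_pos t0) modc_real in h3.
have h4 : t * eta <= t * modc (z - w) by rewrite ler_wpM2l.
by move: h3; case: (ler0P (x - t)) => ? h3; lra.
Qed.

(** The pole [0] can be reached from infinity through the gap of the arc. *)
Lemma appr_arcV w (eta : R) : modc w = 1 -> 0 < eta ->
  appr (arc w eta) (fun z => z^-1).
Proof.
move=> w1 e0.
have L1 z : arc w eta z -> modc z <= 1 by case=> ->.
have h := @appr_pole_ray _ _ L1 w 0 (eta / 2) w1 ltac:(lra).
apply: appr_ext (h _) => [z _|x x0 z az]; first by rewrite mul0r subr0.
by have := @arc_ray w eta 1 x z w1 ler01 x0 az; rewrite !mul1r.
Qed.

Lemma modc_quot_small x y (k : R) : y != 0 -> k <= 1 / 2 ->
  modc x <= k * modc y -> modc (x / (x + y)) <= 2 * k.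
Proof.
move=> y0 k2 xy; have my : 0 < modc y by rewrite modc_gt0.
have h : modc y / 2 <= modc (x + y).
  have := ler_wpM2r (ltW my) k2.
  by have := modc_subr y (- x); rewrite modcN opprK [y + x]addrC; lra.
have k0 : 0 <= k by have := modc_ge0 x; nra.
rewrite modcM modcV ler_pdivrMr; last lra.
by have := ler_wpM2l k0 h; lra.
Qed.

(** A polynomial close to [0] on a disc and close to [1] on an arc of a larger
    circle: the rational function [z ^ N / (z ^ N + rho ^ N)], for an
    intermediate radius [rho], has this property, and all its poles can be
    pushed to infinity. *)
Lemma separator w (eta s t eps : R) :
  modc w = 1 -> 0 < eta -> 0 < s < t -> t <= 1 -> 0 < eps ->
  exists Q, (forall z, modc z <= s -> modc Q.[z] <= eps) /\
    (forall z, arc w eta z -> modc (Q.[t%:C%C * z] - 1) <= eps).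
Proof.
move=> w1 e0 /andP[s0 st] t1 eps0.
pose L z := modc z <= s \/ exists2 y, arc w eta y & z = t%:C%C * y.
have t0 : 0 < t by lra.
have ct y : arc w eta y -> modc (t%:C%C * y) = t.
  by case=> y1 _; rewrite modcM y1 mulr1 modc_pos // ltW.
have L1 z : L z -> modc z <= 1 by case=> [|[y /ct h ->]]; [lra|rewrite h].
pose rho : R := (s + t) / 2.
(* d bounds from below the distance of L to the path followed by the poles. *)
pose d : R := Num.min ((t - s) / 2) (t * eta / 2).
have te0 : 0 < t * eta by rewrite mulr_gt0.
have d0 : 0 < d by rewrite lt_min; apply/andP; split; lra.
have d1 : d <= (t - s) / 2 by rewrite ge_min lexx.
have d2 : d <= t * eta / 2 by rewrite ge_min lexx orbT.
have r0 : 0 < rho by rewrite /rho; lra.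
have ray : appr L (fun z => (z - rho%:C%C * w)^-1).
  apply: (@appr_pole_ray _ L L1 w rho d w1 d0) => x rx z.
  have x0 : 0 <= x by lra.
  case=> [zs|[y ay ->]].
    have := modc_subr (x%:C%C * w) z.
    rewrite modcBC modcM w1 mulr1 modc_pos //; rewrite /rho in rx; lra.
  by apply: le_trans d2 _; apply: arc_ray => //; lra.
have circ a : modc a = rho -> appr L (fun z => (z - a)^-1).
  apply: (@appr_pole_circle _ L rho d _ _ L1 r0 d0 _ ray).
    move=> b mb z [zs|[y ay ->]].
      by have := modc_subr b z; rewrite modcBC mb /rho; lra.
    by have := modc_subr (t%:C%C * y) b; rewrite mb ct // /rho; lra.
  by rewrite modcM w1 mulr1 modc_pos // ltW.
(* On the disc (resp. the arc), the ratio of the moduli of z and rho (resp. of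
   rho and z) is at most q. *)
pose q : R := Num.max (s / rho) (rho / t).
have q01 : 0 <= q < 1.
  rewrite le_max gt_max divr_ge0 ?(ltW s0) ?(ltW r0) //=.
  by rewrite !ltr_pdivrMr // !mul1r /rho; apply/andP; split; lra.
pose mu : R := Num.min (1 / 2) (eps / 4).
have [n hn] := @exprn_small R q mu q01
  ltac:(by rewrite lt_min; apply/andP; split; lra).
have hN : q ^+ n.+1 <= mu.
  apply: le_trans hn; rewrite exprS ler_piMl ?exprn_ge0 //; lra.
have mu2 : mu <= 1 / 2 by rewrite ge_min lexx.
have mue : mu <= eps / 4 by rewrite ge_min lexx orbT.
pose c := (rho%:C%C : C) ^+ n.+1.
have mc : modc c = rho ^+ n.+1 by rewrite modcX modc_pos // ltW.
have c0 : c != 0 by rewrite -modc_gt0 mc exprn_gt0.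
pose F : {poly C} := 'X^(n.+1) + c%:P.
have [rs hrs] : exists rs : seq C, F = \prod_(a <- rs) ('X - a%:P).
  have [rs hrs] := closed_field_poly_normal F.
  exists rs; rewrite {1}hrs lead_coefDl ?lead_coefXn ?scale1r //.
  by rewrite size_polyXn size_polyC c0.
have root a : a \in rs -> modc a = rho.
  move=> ars; have : root F a by rewrite hrs root_prod_XsubC.
  rewrite /root hornerD hornerXn hornerC addr_eq0 => /eqP h.
  apply/eqP; rewrite -(@eqrXn2 _ n.+1) ?modc_ge0 // ?(ltW r0) //.
  by rewrite -modcX h modcN mc.
have hF : appr L (fun z => z ^+ n.+1 / (z ^+ n.+1 + c)).
  have hp : appr L (fun z => \prod_(a <- rs) (z - a)^-1).
    by apply: appr_prod => // a /root; exact: circ.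
  apply: appr_ext (apprM L1 (apprX L1 n.+1 (@appr_id R L)) hp) => z _.
  congr (_ * _); have -> : z ^+ n.+1 + c = F.[z].
    by rewrite hornerD hornerXn hornerC.
  rewrite hrs horner_prod -prodfV; apply: eq_bigr => a _.
  by rewrite hornerXsubC.
have [Q hQ] := hF (eps / 2) ltac:(lra).
exists Q; split=> z hz.
  have h : modc (z ^+ n.+1 / (z ^+ n.+1 + c)) <= 2 * mu.
    apply: modc_quot_small => //; rewrite mc modcX.
    apply: le_trans (_ : (q * rho) ^+ n.+1 <= _).
      have qr : 0 <= q * rho by apply: mulr_ge0; lra.
      rewrite lerXn2r ?nnegrE ?modc_ge0 //.
      apply: le_trans hz _; rewrite -ler_pdivrMr //.
      by rewrite le_max lexx.
    by rewrite exprMn ler_wpM2r // exprn_ge0 // ltW.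
  have := hQ z (or_introl hz).
  by have := modc_subr Q.[z] (z ^+ n.+1 / (z ^+ n.+1 + c)); lra.
set y := t%:C%C * z; have my : modc y = t by exact: ct.
have yt0 : y ^+ n.+1 != 0 by rewrite -modc_gt0 modcX my exprn_gt0.
have h : modc (c / (c + y ^+ n.+1)) <= 2 * mu.
  apply: modc_quot_small => //; rewrite mc modcX my.
  apply: le_trans (_ : (q * t) ^+ n.+1 <= _).
    have qt : 0 <= q * t by apply: mulr_ge0; lra.
    rewrite lerXn2r ?nnegrE ?(ltW r0) //.
    by rewrite -ler_pdivrMr // le_max lexx orbT.
  by rewrite exprMn ler_wpM2r // exprn_ge0 // ltW.
have nz : y ^+ n.+1 + c != 0.
  rewrite -modc_gt0; have h1 := modc_subr (y ^+ n.+1) (- c).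
  rewrite opprK modcN mc modcX my in h1; apply: lt_le_trans h1.
  by rewrite subr_gt0 ltrXn2r ?(ltW r0) //= /rho; lra.
have e1 : y ^+ n.+1 / (y ^+ n.+1 + c) - 1 = - (c / (c + y ^+ n.+1)).
  by rewrite [c + _]addrC; apply: (mulIf nz); rewrite mulrBl mulNr !divfK // mul1r; ring.
have := hQ y (or_intror (ex_intro2 _ _ z hz erefl)).
have := modc_tri Q.[y] (y ^+ n.+1 / (y ^+ n.+1 + c)) 1.
by rewrite e1 modcN; lra.
Qed.

(** Runge's theorem for a disc and an arc of a larger circle. *)
Lemma runge_arc w (eta s t eps : R) h :
  modc w = 1 -> 0 < eta -> 0 < s < t -> t <= 1 -> 0 < eps ->
  exists P, (forall z, modc z <= s -> modc P.[z] <= eps) /\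
    (forall z, arc w eta z -> modc (P.[t%:C%C * z] - h.[t%:C%C * z]) <= eps).
Proof.
move=> w1 e0 st t1 eps0; have [M M0 hM] := poly_bounded h.
have [Q [Q0 Q1]] := @separator w eta s t (eps / M) w1 e0 st t1
  ltac:(by rewrite divr_gt0).
case/andP: st => s0 st; exists (Q * h); split=> z hz.
  rewrite hornerM modcM -[eps](@divfK _ M) ?gt_eqF //.
  by rewrite ler_pM ?modc_ge0 ?Q0 // hM //; lra.
rewrite hornerM -[X in _ - X]mul1r -mulrBl modcM -[eps](@divfK _ M) ?gt_eqF //.
rewrite ler_pM ?modc_ge0 ?Q1 // hM // modcM modc_pos; last lra.
by case: hz => -> _; rewrite mulr1.
Qed.

(** A task prescribes the values of a polynomial, those of [target], on the arc
    [arc omitted gap] dilated by [radius]. *)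
Record task := Task {
  radius : R; omitted : C; gap : R; target : {poly C} }.

Definition proper_task (T : task) :=
  [/\ modc (omitted T) = 1, 0 < gap T & radius T <= 1].

(** The polynomial [P] carries out the task [T] up to [eps]. *)
Definition fulfils P (eps : R) (T : task) := forall z,
  arc (omitted T) (gap T) z ->
  modc (P.[(radius T)%:C%C * z] - (target T).[(radius T)%:C%C * z]) <= eps.

(** Tasks at increasing radii are carried out one after the other: the
    correction made at a radius is small on the discs of the preceding ones. *)
Lemma runge_sorted_arcs n (T : nat -> task) (s eps : R) :
  0 < s -> 0 < eps -> (forall i, (i < n)%N -> proper_task (T i)) ->
  (forall i, (i < n)%N -> s < radius (T i)) ->
  (forall i j, (i < j < n)%N -> radius (T i) < radius (T j)) ->
  exists P, (forall z, modc z <= s -> modc P.[z] <= eps) /\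
    (forall i, (i < n)%N -> fulfils P eps (T i)).
Proof.
elim: n T s eps => [|n IH] T s eps s0 eps0 hT hs hij.
  by exists 0; split=> // z _; rewrite horner0 modc0 ltW.
have [w1 e0 t1] := hT 0%N isT; have st := hs 0%N isT.
have [P [P0 P1]] := @runge_arc _ _ s (radius (T 0%N)) (eps / 2) (target (T 0%N)) w1 e0
  ltac:(by rewrite s0 st) t1 ltac:(lra).
pose T' i := let U := T i.+1 in Task (radius U) (omitted U) (gap U) (target U - P).
have [|||||Q [Q0 Q1]] := IH T' (radius (T 0%N)) (eps / 2).
- lra.
- lra.
- by move=> i ni; exact: hT.
- by move=> i ni; apply: hij; rewrite ltnS.
- by move=> i j ij; exact: hij.
exists (P + Q); split=> [z zs|[_|i ni] z az].
- rewrite hornerD; apply: le_trans (modcD _ _) _.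
  by have := P0 z zs; have := Q0 z ltac:(lra); lra.
- rewrite hornerD addrAC; apply: le_trans (modcD _ _) _.
  set y := _ * z; have yr : modc y <= radius (T 0%N).
    rewrite modcM modc_pos; last lra.
    by case: az => -> _; rewrite mulr1.
  by have := P1 z az; have := Q0 y yr; lra.
have := Q1 i ni z az; rewrite /= hornerD hornerN opprD opprK.
by rewrite hornerD [_.[_] + Q.[_]]addrC addrA addrAC; lra.
Qed.

End Arcs.

Section FiniteArcs.
Variable R : realType.
Local Notation C := R[i].

Lemma runge_arcs (I : eqType) (A : seq I) (T : I -> task R) (s eps : R) :
  0 < s -> 0 < eps -> (forall i, i \in A -> proper_task (T i)) ->
  (forall i, i \in A -> s < radius (T i)) ->
  uniq [seq radius (T i) | i <- A] ->
  exists P : {poly C}, (forall z, modc z <= s -> modc P.[z] <= eps) /\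
    (forall i, i \in A -> fulfils P eps (T i)).
Proof.
move=> s0 eps0 hT hs hu; case: A => [|i0 A] in hT hs hu *.
  by exists 0; split=> // z _; rewrite horner0 modc0 ltW.
move: (i0 :: A) hT hs hu => {}A hT hs hu.
pose key i := radius (T i).
pose A' := sort (relpre key <=%O) A.
have sA : size A' = size A by rewrite size_sort.
have mA i : (i < size A)%N -> nth i0 A' i \in A.
  by rewrite -sA => /(mem_nth i0); rewrite mem_sort.
have A'lt : sorted (relpre key <%O) A'.
  by rewrite -sorted_map -sort_map sort_lt_sorted.
have [|||P [P0 P1]] := @runge_sorted_arcs R (size A) (fun i => T (nth i0 A' i)) s eps s0 eps0.
- by move=> i /mA; exact: hT.
- by move=> i /mA; exact: hs.
- move=> i j /andP[ij jA].
  have tr : transitive (relpre key <%O) by move=> x y z; exact: lt_trans.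
  apply: (sorted_ltn_nth tr i0 A'lt) => //; rewrite inE sA //.
  exact: ltn_trans jA.
exists P; split=> // i iA; have iA' : i \in A' by rewrite mem_sort.
have := P1 (index i A'); rewrite nth_index //; apply.
by rewrite -sA index_mem.
Qed.

End FiniteArcs.

(** * Approximation of continuous functions *)

Section StoneWeierstrass.
Variable R : realType.
Local Notation C := R[i].
Implicit Types (x y z w : C) (K : set C) (g : C -> C).

Lemma modc_sqr_circle y z : modc y = 1 -> modc z = 1 ->
  ((modc (z - y)) ^+ 2)%:C%C = (z - y) * (z^-1 - y^-1) :> C.
Proof.
have conjV x : modc x = 1 -> (x^*)%C = x^-1.
  move=> x1; have x0 : x != 0 by rewrite -modc_gt0 x1.
  by apply: (mulfI x0); rewrite divff // -sqr_normc normE x1 expr1n.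
move=> y1 z1; rewrite rmorphXn /= -normE sqr_normc.
by rewrite [in X in _ * X](rmorphB conjc) /= !conjV.
Qed.

(** A function with a modulus of continuity on a totally bounded part of a
    proper arc is a uniform limit of polynomials. On the circle, [z^-1] is the
    conjugate of [z], so [phi y z = 1 - |z - y|^2 / 4] is such a limit; it peaks
    at [y], and for a fine net of points [y] and large [N], the average of the
    [g y] with weights [phi y z ^+ N] is close to [g z]. *)
Lemma appr_continuous w (eta : R) K g : modc w = 1 -> 0 < eta ->
  K `<=` arc w eta ->
  (forall eps : R, 0 < eps -> exists2 d : R, 0 < d &
     forall y z, K y -> K z -> modc (z - y) <= d -> modc (g y - g z) <= eps) ->
  (forall d : R, 0 < d -> exists2 S : seq C, {in S, forall y, K y} &
     forall z, K z -> exists2 y, y \in S & modc (z - y) <= d) ->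
  appr K g.
Proof.
move=> w1 e0 Karc gcont net.
have K1 z : K z -> modc z = 1 by move=> /Karc[].
have KL z : K z -> modc z <= 1 by move=> /K1 ->.
have hV : appr K (fun z => z^-1).
  move=> e /(appr_arcV w1 e0)[p hp]; exists p => z /Karc; exact: hp.
pose phi y z : R := 1 - modc (z - y) ^+ 2 / 4.
have mle y z : K y -> K z -> modc (z - y) <= 2.
  by move=> /K1 y1 /K1 z1; have := modcB z y; rewrite y1 z1; lra.
have phi0 y z : K y -> K z -> 0 <= phi y z <= 1.
  move=> Ky Kz; have := mle y z Ky Kz; have := modc_ge0 (z - y); rewrite /phi.
  by move=> h1 h2; apply/andP; split; nra.
(* On the circle, |z - y|^2 is a polynomial in z and z^-1. *)
have hphi y : K y -> appr K (fun z => (phi y z)%:C%C).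
  move=> Ky.
  have h1 := apprD (@appr_id R K) (@appr_cst R K (- y)).
  have h2 := apprD hV (@appr_cst R K (- y^-1)).
  have h3 := apprD (@appr_cst R K 1) (apprZ KL (- 4^-1) (apprM KL h1 h2)).
  apply: appr_ext h3 => z Kz /=.
  rewrite /phi rmorphB rmorphM /= modc_sqr_circle ?K1 //.
  by rewrite fmorphV /= rmorph_nat rmorph1 mulNr [_ / 4]mulrC.
apply: appr_lim => e eps0.
have [d1 d10 hd1] := gcont (e / 2) ltac:(lra).
pose d : R := Num.min d1 1.
have d0 : 0 < d by rewrite lt_min d10 ltr01.
have dd1 : d <= d1 by rewrite ge_min lexx.
have dl1 : d <= 1 by rewrite ge_min lexx orbT.
have [S SK hS] := net (d / 2) ltac:(lra).
have [S0|S0] := eqVneq S [::].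
  exists g => [|z]; last by rewrite subrr modc0 ltW.
  by move=> e' _; exists 0 => z /hS[y]; rewrite S0.
pose m : R := (size S)%:R.
have m1 : 1 <= m by rewrite ler1n lt0n size_eq0.
pose M : R := \sum_(y <- S) modc (g y) + e.
have M0 : 0 < M by rewrite ltr_wpDl // sumr_ge0 // => y _; exact: modc_ge0.
have hM y : y \in S -> modc (g y) <= M.
  move=> yS; rewrite /M (big_rem y yS) /= -addrA ler_wpDr // addr_ge0 ?(ltW eps0) //.
  by rewrite sumr_ge0 // => x _; exact: modc_ge0.
have hMK z : K z -> modc (g z) <= M + e.
  move=> Kz; have [y yS zy] := hS z Kz.
  have := hd1 y z (SK y yS) Kz ltac:(lra).
  by rewrite modcBC; have := modc_subr (g z) (g y); have := hM y yS; lra.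
(* phi is at least a at the points of the net close to z, and at most b at those
   further than d from z. *)
pose a : R := 1 - d ^+ 2 / 16; pose b : R := 1 - d ^+ 2 / 4.
have dd : 0 < d ^+ 2 by rewrite exprn_gt0.
have dd2 : d ^+ 2 <= 1 by rewrite exprn_ile1 // ltW.
have a0 : 0 < a by rewrite /a; lra.
have b0 : 0 < b by rewrite /b; lra.
have [N hN] := @exprn_small R (b / a) (e / 2 / ((M + (M + e)) * m))
  ltac:(by rewrite divr_ge0 ?(ltW a0) ?(ltW b0) //= ltr_pdivrMr // mul1r /a /b; lra)
  ltac:(rewrite !divr_gt0 // mulr_gt0; lra).
pose D z : R := \sum_(y <- S) phi y z ^+ N.
have Dm z : K z -> D z <= m.
  move=> Kz; rewrite /m -(card_ord (size S)) -sum1_card natr_sum /D (big_nth 0) big_mkord.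
  apply: ler_sum => i _; have /andP[h1 h2] := phi0 _ z (SK _ (mem_nth 0 (ltn_ord i))) Kz.
  by rewrite exprn_ile1.
have Da z : K z -> a ^+ N <= D z.
  move=> Kz; have [y yS zy] := hS z Kz; rewrite /D (big_rem y yS) /=.
  apply: ler_wpDr.
    rewrite big_seq sumr_ge0 // => x /mem_rem/SK Kx.
    by have /andP[h _] := phi0 x z Kx Kz; exact: exprn_ge0.
  have /andP[h _] := phi0 y z (SK y yS) Kz.
  rewrite lerXn2r ?nnegrE ?(ltW a0) // /a /phi.
  by have := modc_ge0 (z - y); nra.
have aN : 0 < a ^+ N by rewrite exprn_gt0.
have hsum (c : C -> C) : appr K (fun z => \sum_(y <- S) c y * (phi y z ^+ N)%:C%C).
  rewrite [X in appr K X](_ : _ =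
      fun z => \sum_(y <- S) (if y \in S then c y * (phi y z ^+ N)%:C%C else 0)).
    apply: (appr_sum S (F := fun y z => if y \in S then _ else _)) => y.
    have [/SK Ky|_] := boolP (y \in S); last exact: appr_cst.
    apply: apprZ => //; apply: appr_ext (apprX KL N (hphi y Ky)) => z _ /=.
    by rewrite rmorphXn.
  by apply/funext => z; rewrite !big_seq; apply: eq_bigr => y ->.
have hD : appr K (fun z => (D z)%:C%C).
  apply: appr_ext (hsum (fun=> 1)) => z _; rewrite /D rmorph_sum /=.
  by apply: eq_bigr => y _; rewrite mul1r.
(* D takes its values in [a ^+ N, m], so that 1 - D / m is bounded away from 1. *)
have hDV : appr K (fun z => ((D z)%:C%C)^-1).
  have h1 := apprD (@appr_cst R K 1) (apprZ KL (- (m^-1)%:C%C) hD).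
  have h2 z : K z -> modc (1 + - (m^-1)%:C%C * (D z)%:C%C) <= 1 - a ^+ N / m.
    move=> Kz; have -> : 1 + - (m^-1)%:C%C * (D z)%:C%C = (1 - D z / m)%:C%C :> C.
      by rewrite rmorphB rmorphM rmorph1 mulNr [in RHS]mulrC.
    rewrite modc_pos ?lerB ?ler_pM2r ?invr_gt0 ?Da //; try lra.
    by rewrite subr_ge0 ler_pdivrMr ?mul1r ?Dm //; lra.
  have h3 := appr_geom KL (q := 1 - a ^+ N / m)
    ltac:(by rewrite ltrBlDr ltrDl divr_gt0 //; lra) h1 h2.
  apply: appr_ext (apprZ KL (m^-1)%:C%C h3) => z Kz.
  have mz : (m%:C)%C != 0 :> C.
    by rewrite -modc_gt0 modc_pos; lra.
  rewrite opprD addNKr mulNr opprK invfM mulrA fmorphV divff ?mul1r //.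
  by rewrite invr_eq0.
exists (fun z => (\sum_(y <- S) g y * (phi y z ^+ N)%:C%C) * ((D z)%:C%C)^-1).
  by apply: apprM.
move=> z Kz; have Dz : 0 < D z by apply: lt_le_trans (Da z Kz).
have mz : ((D z)%:C)%C != 0 :> C by rewrite -modc_gt0 modc_pos // ltW.
have -> : (\sum_(y <- S) g y * (phi y z ^+ N)%:C%C) * ((D z)%:C%C)^-1 - g z =
    (\sum_(y <- S) (g y - g z) * (phi y z ^+ N)%:C%C) * ((D z)%:C%C)^-1.
  apply: (mulIf mz); rewrite mulrBl !divfK // /D rmorph_sum /= mulr_sumr -sumrB.
  by apply: eq_bigr => y _; rewrite mulrBl.
rewrite modcM modcV modc_pos ?(ltW Dz) // ler_pdivrMr //.
apply: le_trans (modc_sum _ _ _) _.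
apply: le_trans (_ : \sum_(y <- S) (e / 2 * phi y z ^+ N + (M + (M + e)) * b ^+ N) <= _).
  rewrite !big_seq; apply: ler_sum => y yS; have Ky := SK y yS.
  have /andP[p0 p1] := phi0 y z Ky Kz.
  have pN : 0 <= phi y z ^+ N by rewrite exprn_ge0.
  have bN : 0 <= b ^+ N by rewrite exprn_ge0 // ltW.
  rewrite modcM modc_pos //.
  (* Close points contribute through the modulus of continuity, distant ones
     through the smallness of b ^+ N compared with a ^+ N. *)
  have [zd|zd] := leP (modc (z - y)) d.
    apply: le_trans (_ : e / 2 * phi y z ^+ N <= _).
      by rewrite ler_wpM2r // hd1 //; lra.
    by rewrite lerDl mulr_ge0 //; lra.
  apply: le_trans (_ : (M + (M + e)) * b ^+ N <= _); last first.
    by rewrite lerDr mulr_ge0 //; lra.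
  apply: ler_pM => //; first exact: modc_ge0.
    by apply: le_trans (modcB _ _) _; rewrite lerD ?hM ?hMK.
  rewrite lerXn2r ?nnegrE ?(ltW b0) // /b /phi; nra.
rewrite big_split /= -mulr_sumr -/(D z) big_const_seq count_predT iter_addr_0.
rewrite -[_ *+ size S]mulr_natr -/m [e in leRHS]splitr [leRHS]mulrDl lerD2l.
apply: le_trans (_ : e / 2 * a ^+ N <= _); last first.
  by rewrite ler_wpM2l ?Da //; lra.
move: hN; rewrite expr_div_n ler_pdivrMr // mulrAC ler_pdivlMr; last first.
  by rewrite mulr_gt0; lra.
by rewrite mulrCA mulrA.
Qed.

(** The Gaussian rational with the given real and imaginary parts. *)
Definition gauss_rat (c : rat * rat) : C := Complex (ratr c.1) (ratr c.2).

(** The polynomial with the given list of Gaussian rational coefficients. *)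
Definition rat_poly (s : seq (rat * rat)) : {poly C} :=
  \poly_(i < size s) gauss_rat (nth 0 s i).

Lemma gauss_rat_dense (a : C) (d : R) : 0 < d ->
  exists c, modc (gauss_rat c - a) <= d.
Proof.
move=> d0; case: a => x y.
have near (t : R) : exists q : rat, `|ratr q - t| <= d / 2.
  have [q] := @rat_in_itvoo R (t - d / 2) (t + d / 2) ltac:(lra).
  by rewrite in_itv /= => /andP[h1 h2]; exists q; rewrite ler_norml; apply/andP; split; lra.
have [q hq] := near x; have [q' hq'] := near y; exists (q, q').
rewrite /modc /gauss_rat /= -(@ler_sqr R) ?nnegrE ?sqrtr_ge0 ?(ltW d0) //.
rewrite sqr_sqrtr ?addr_ge0 ?sqr_ge0 // -(real_normK (num_real (ratr q - x))).
rewrite -(real_normK (num_real (ratr q' - y))).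
have := normr_ge0 (ratr q - x); have := normr_ge0 (ratr q' - y); nra.
Qed.

Lemma rat_poly_dense (p : {poly C}) (eps : R) : 0 < eps ->
  exists s, forall z, modc z <= 1 -> modc ((rat_poly s).[z] - p.[z]) <= eps.
Proof.
move=> e0; pose n := size p.
have d0 : 0 < eps / n.+1%:R by rewrite divr_gt0.
have /choice[c hc] : forall i, exists c, modc (gauss_rat c - p`_i) <= eps / n.+1%:R.
  by move=> i; exact: gauss_rat_dense.
exists (mkseq c n) => z z1; rewrite horner_poly size_mkseq horner_coef -sumrB.
apply: le_trans (modc_sum _ _ _) _.
apply: le_trans (_ : \sum_(i < n) eps / n.+1%:R <= _).
  apply: ler_sum => i _; rewrite nth_mkseq // -mulrBl modcM modcX.
  by rewrite -[leRHS]mulr1 ler_pM ?exprn_ge0 ?modc_ge0 // exprn_ile1 ?modc_ge0.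
rewrite sumr_const card_ord -[_ *+ n]mulr_natr mulrAC ler_pdivrMr // ler_pM2l //.
by rewrite ler_nat.
Qed.

End StoneWeierstrass.

(** * Cauchy estimates for polynomials *)

Section CauchyEstimates.
Variable R : realType.
Local Notation C := R[i].
Implicit Types (x y z w c : C) (P T U : {poly C}).

Lemma prim_root_exists n : (0 < n)%N -> exists xi : C, n.-primitive_root xi.
Proof.
move=> n0; pose p : {poly C} := 'X^(n) - 1.
have [r Dp] := closed_field_poly_normal p.
rewrite (monicP _) ?monicXnsubC // scale1r in Dp.
have rn1 : all n.-unity_root r by apply/allP => z; rewrite -root_prod_XsubC -Dp.
have sz_r : (n < (size r).+1)%N.
  by rewrite -(size_prod_XsubC r id) -Dp size_XnsubC.
have [|z _ hz] := hasP (has_prim_root n0 rn1 _ sz_r); last by exists z.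
by rewrite -separable_prod_XsubC -Dp separable_Xn_sub_1 // pnatr_eq0 -lt0n.
Qed.

(** The coefficients are averages of the values at the vertices of a regular
    polygon inscribed in the circle. *)
Lemma cauchy_coef P (rho M : R) j : 0 < rho ->
  (forall z, modc z = rho -> modc P.[z] <= M) -> modc P`_j * rho ^+ j <= M.
Proof.
move=> r0 hM; pose N := maxn (size P) j.+1.
have jN : (j < N)%N by rewrite leq_max leqnn orbT.
have PN : (size P <= N)%N by rewrite leq_max leqnn.
have N0 : (0 < N)%N by apply: leq_trans jN.
have [xi hxi] := prim_root_exists N0.
have xi1 : modc xi = 1.
  apply/eqP; rewrite -(@eqrXn2 _ N) ?modc_ge0 //.
  by rewrite expr1n -modcX (prim_expr_order hxi) modc1.
have xi0 : xi != 0 by rewrite -modc_gt0 xi1.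
pose F (k : 'I_N) := P.[rho%:C%C * xi ^+ k] / (xi ^+ j) ^+ k.
have FM k : modc (F k) <= M.
  rewrite modcM modcV !modcX xi1 !expr1n invr1 mulr1 hM //.
  by rewrite modcM modcX xi1 expr1n mulr1 modc_pos // ltW.
have sumF : \sum_k F k = P`_j * rho%:C%C ^+ j * N%:R.
  transitivity (\sum_(i < N) P`_i * rho%:C%C ^+ i *
      \sum_(k < N) (xi ^+ i / xi ^+ j) ^+ k).
    rewrite /F; under eq_bigr do rewrite (horner_coef_wide _ PN) mulr_suml.
    rewrite exchange_big; apply: eq_bigr => i _; rewrite mulr_sumr.
    apply: eq_bigr => k _.
    by rewrite !exprMn exprVn -!exprM [(k * i)%N]mulnC !mulrA.
  rewrite (bigD1 (Ordinal jN)) //= divff ?expf_neq0 //.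
  under eq_bigr do rewrite expr1n.
  rewrite sumr_const card_ord big1 ?addr0 // => i ij.
  set y := xi ^+ i / xi ^+ j.
  have y1 : y - 1 != 0.
    rewrite subr_eq0 -(inj_eq (mulIf (expf_neq0 j xi0))) divfK ?expf_neq0 // mul1r.
    by rewrite (eq_prim_root_expr hxi) !modn_small.
  have yN : y ^+ N = 1.
    rewrite exprMn exprVn -!exprM ![(_ * N)%N]mulnC !exprM (prim_expr_order hxi).
    by rewrite !expr1n divff.
  have /eqP := subrX1 y N; rewrite yN subrr eq_sym mulf_eq0 (negPf y1) /=.
  by move=> /eqP ->; rewrite mulr0.
have : modc (\sum_k F k) <= M * N%:R.
  apply: le_trans (modc_sum _ _ _) _.
  apply: le_trans (_ : \sum_(k < N) M <= _); first exact: ler_sum.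
  by rewrite sumr_const card_ord mulr_natr.
by rewrite sumF !modcM modc_nat modcX modc_pos ?(ltW r0) // ler_pM2r // ltr0n.
Qed.

(** A weak form of the maximum principle. *)
Lemma weak_maximum P (rho rho' M : R) : 0 <= rho' < rho ->
  (forall z, modc z = rho -> modc P.[z] <= M) ->
  forall z, modc z <= rho' -> modc P.[z] <= M * (rho / (rho - rho')).
Proof.
move=> /andP[r0 r1] hM z hz; have rr : 0 < rho by lra.
have M0 : 0 <= M.
  apply: le_trans (hM rho%:C%C _); first exact: modc_ge0.
  by rewrite modc_pos // ltW.
pose q := rho' / rho.
have q0 : 0 <= q by rewrite divr_ge0 // ltW.
have q1 : q < 1 by rewrite ltr_pdivrMr // mul1r.
rewrite horner_coef; apply: le_trans (modc_sum _ _ _) _.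
apply: le_trans (_ : \sum_(i < size P) M * q ^+ i <= _).
  apply: ler_sum => i _; rewrite modcM modcX.
  have rn : 0 < rho ^+ i by rewrite exprn_gt0.
  rewrite expr_div_n mulrA ler_pdivlMr // mulrAC.
  apply: ler_pM; rewrite ?mulr_ge0 ?exprn_ge0 ?modc_ge0 ?(ltW rr) //.
    exact: cauchy_coef.
  by rewrite lerXn2r ?nnegrE ?modc_ge0.
rewrite -mulr_sumr ler_wpM2l // ler_pdivlMr; last lra.
have e : rho - rho' = rho * (1 - q) by rewrite /q; field; rewrite gt_eqF.
rewrite e mulrCA -[leRHS]mulr1 ler_pM2l // mulrC -[1 - q]opprB mulNr -subrX1.
by rewrite opprB lerBlDr lerDl exprn_ge0.
Qed.

(** The quotient of [P - P.[w]] by [X - w], bounded on the circle of radius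
    [rho] by that of [P], and inside by the weak maximum principle. *)
Lemma difference_quotient P w (rho rho' M : R) : 0 <= rho' < rho ->
  modc w <= rho' -> (forall z, modc z = rho -> modc P.[z] <= M) ->
  modc P.[w] <= M ->
  exists T, [/\ forall z, P.[z] - P.[w] = T.[z] * (z - w),
    forall z, modc z = rho -> modc T.[z] <= 2 * M / (rho - rho') &
    forall z, modc z <= rho' ->
      modc T.[z] <= 2 * M / (rho - rho') * (rho / (rho - rho'))].
Proof.
move=> rr wr hM hw; have /andP[r0 r1] := rr.
have : root (P - P.[w]%:P) w by rewrite /root hornerD hornerN hornerC subrr.
move=> /factor_theorem[T hT].
have eT z : P.[z] - P.[w] = T.[z] * (z - w).
  by have := congr1 (horner^~ z) hT; rewrite /= hornerM hornerXsubC hornerD hornerN hornerC.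
have T1 z : modc z = rho -> modc T.[z] <= 2 * M / (rho - rho').
  move=> zr; have zw : rho - rho' <= modc (z - w).
    by have := modc_subr z w; lra.
  rewrite ler_pdivlMr ?subr_gt0 //.
  apply: le_trans (ler_wpM2l (modc_ge0 _) zw) _; rewrite -modcM -eT.
  by apply: le_trans (modcB _ _) _; have := hM z zr; lra.
by exists T; split=> // z; exact: weak_maximum.
Qed.

(** Second order Taylor estimates, uniform with respect to the polynomial: the
    remainder is obtained by taking difference quotients twice. *)
Lemma taylor2 (rho rho' : R) : 0 <= rho' < rho -> exists2 k : R, 0 < k &
  forall P (M : R), (forall z, modc z <= rho -> modc P.[z] <= M) ->
  forall w, modc w <= rho' -> exists2 c, modc c <= k * M &
  forall z, modc z <= rho' ->
    modc (P.[z] - P.[w] - (z - w) * c) <= k * M * modc (z - w) ^+ 2.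
Proof.
move=> rr; have /andP[r0 r1] := rr; have d0 : 0 < rho - rho' by lra.
pose a := rho / (rho - rho'); pose b := 2 / (rho - rho').
have a1 : 1 <= a by rewrite ler_pdivlMr //; lra.
have a0 : 0 < a by lra.
have b0 : 0 < b by rewrite divr_gt0.
exists (b * a + b * (b * a) * a) => [|P M hM w wr].
  have ba0 : 0 < b * a by exact: mulr_gt0.
  by apply: addr_gt0 => //; do 2!apply: mulr_gt0 => //.
have M0 : 0 <= M by have := hM w ltac:(lra); have := modc_ge0 P.[w]; lra.
have bM0 : 0 <= b * M by rewrite mulr_ge0 // ltW.
have [||T [eT T1 T2]] := @difference_quotient P w rho rho' M rr wr.
- by move=> z zr; apply: hM; rewrite zr.
- by apply: hM; lra.
rewrite -[2 * M / _]mulrAC -/b -/a in T1 T2.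
have [||U [eU _ U2]] := @difference_quotient T w rho rho' (b * M * a) rr wr.
- move=> z /T1 h; apply: le_trans h _; rewrite ler_peMr //.
- exact: T2.
have e : 2 * (b * M * a) / (rho - rho') * a = b * (b * a) * a * M.
  by rewrite /b; ring.
rewrite -/a e in U2.
have h0 : 0 <= b * (b * a) * a * M.
  by rewrite -mulrA mulr_ge0 // mulr_ge0 // ltW // mulr_gt0.
have h1 : 0 <= b * M * a by rewrite mulr_ge0 // ltW.
exists T.[w] => [|z zr]; first by have := T2 w wr; lra.
have -> : P.[z] - P.[w] - (z - w) * T.[w] = U.[z] * (z - w) ^+ 2.
  by rewrite eT [(z - w) * _]mulrC -mulrBl eU expr2 mulrA.
rewrite modcM modcX ler_wpM2r ?exprn_ge0 ?modc_ge0 //.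
by have := U2 z zr; lra.
Qed.
End CauchyEstimates.

(** * Series of polynomials on the unit disc *)

Section Series.
Variable R : realType.
Local Notation C := R[i].
Implicit Types (z w c : C).

Lemma half_exp_small (eps : R) : 0 < eps -> exists n, (1 / 2) ^+ n <= eps.
Proof. by move=> e0; apply: exprn_small => //; lra. Qed.

Lemma half_exp_gt0 n : 0 < ((1 / 2) ^+ n : R).
Proof. by rewrite exprn_gt0 //; lra. Qed.

(** Explicit rate of convergence of a series dominated by a geometric one:
    the limit is the supremum of the partial sums diminished by a bound of the
    remainder. *)
Lemma real_series (u : nat -> R) K (A : R) :
  (forall k, (K <= k)%N -> `|u k| <= A * (1 / 2) ^+ k) ->
  exists l, forall n, (K <= n)%N ->
    `|\sum_(k < n) u k - l| <= 2 * A * (1 / 2) ^+ n.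
Proof.
move=> hu; pose S n := \sum_(k < n) u k.
pose a n := S n - 2 * A * (1 / 2) ^+ n; pose b n := S n + 2 * A * (1 / 2) ^+ n.
have step n : (K <= n)%N -> a n <= a n.+1 /\ b n.+1 <= b n.
  move=> /hu; rewrite /a /b /S big_ord_recr /= exprS ler_norml => /andP[h1 h2].
  by split; lra.
have mono n j : (K <= n)%N -> a n <= a (n + j)%N /\ b (n + j)%N <= b n.
  move=> Kn; elim: j => [|j [IH1 IH2]]; first by rewrite addn0.
  have [h1 h2] := step (n + j)%N (leq_trans Kn (leq_addr _ _)).
  by rewrite addnS; split; [apply: le_trans h1|apply: le_trans IH2].
have ab n : (K <= n)%N -> a n <= b n.
  move=> Kn; have := hu n Kn; have := half_exp_gt0 n; have := normr_ge0 (u n).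
  by rewrite /a /b; move=> h1 h2 h3; lra.
have abm n p : (K <= n)%N -> (K <= p)%N -> a n <= b p.
  move=> Kn Kp; have [h1 _] := mono n p Kn; have [_ h2] := mono p n Kp.
  rewrite [(p + n)%N]addnC in h2.
  by apply: le_trans h1 _; apply: le_trans h2; apply: ab; rewrite (leq_trans Kn) ?leq_addr.
pose E := [set a n | n in [set n | (K <= n)%N]].
exists (sup E) => n Kn; rewrite ler_norml -/(S n).
have E0 : E !=set0 by exists (a K), K => /=.
have Eb p : (K <= p)%N -> ubound E (b p) by move=> Kp _ [m Km <-]; exact: abm.
have h1 : a n <= sup E by apply: ub_le_sup; [exists (b n); exact: Eb|exists n].
have h2 : sup E <= b n by apply: ge_sup => //; exact: Eb.
by move: h1 h2; rewrite /a /b => h1 h2; apply/andP; split; lra.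
Qed.

Lemma modc_Re z : `|complex.Re z| <= modc z.
Proof. by rewrite -lecR -normE normc_ge_Re. Qed.

Lemma modc_Im z : `|complex.Im z| <= modc z.
Proof.
have := modc_Re (z * 'i%C); rewrite ReiNIm normrN modcM.
by rewrite [modc 'i%C](_ : _ = 1) ?mulr1 // /modc /= expr0n expr1n add0r sqrtr1.
Qed.

Lemma modc_ReIm z : modc z <= `|complex.Re z| + `|complex.Im z|.
Proof.
rewrite {1}(complexE z); apply: le_trans (modcD _ _) _.
rewrite modcM !modc_real [modc 'i%C](_ : _ = 1) ?mul1r //.
by rewrite /modc /= expr0n expr1n add0r sqrtr1.
Qed.

Lemma complex_series (u : nat -> C) K (A : R) :
  (forall k, (K <= k)%N -> modc (u k) <= A * (1 / 2) ^+ k) ->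
  exists l, forall n, (K <= n)%N ->
    modc (\sum_(k < n) u k - l) <= 4 * A * (1 / 2) ^+ n.
Proof.
move=> hu; have [|x hx] := @real_series (fun k => complex.Re (u k)) K A.
  by move=> k /hu; exact: le_trans (modc_Re _).
have [|y hy] := @real_series (fun k => complex.Im (u k)) K A.
  by move=> k /hu; exact: le_trans (modc_Im _).
exists (Complex x y) => n Kn; apply: le_trans (modc_ReIm _) _.
have eRe : complex.Re (\sum_(k < n) u k - Complex x y) = \sum_(k < n) complex.Re (u k) - x.
  by rewrite raddfB raddf_sum.
have eIm : complex.Im (\sum_(k < n) u k - Complex x y) = \sum_(k < n) complex.Im (u k) - y.
  by rewrite raddfB raddf_sum.
by rewrite eRe eIm; have := hx n Kn; have := hy n Kn; lra.
Qed.

(** The radii of discs centred at [0] that exhaust the unit disc. *)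
Definition exhaust (k : nat) : R := 1 - (1 / 2) ^+ k.+1.

Lemma exhaust_lt1 k : exhaust k < 1.
Proof. by rewrite /exhaust ltrBlDr ltrDl half_exp_gt0. Qed.

Lemma exhaust_gt0 k : 0 < exhaust k.
Proof. by rewrite /exhaust subr_gt0 exprn_ilt1 //; lra. Qed.

Lemma exhaust_le j k : (j <= k)%N -> exhaust j <= exhaust k.
Proof. by move=> jk; rewrite /exhaust lerB // ler_wiXn2l //; lra. Qed.

Lemma exhaust_cofinal (x : R) : x < 1 -> exists k, x < exhaust k.
Proof.
move=> x1; have [n hn] := @half_exp_small (1 - x) ltac:(lra).
exists n; rewrite /exhaust exprS; have := half_exp_gt0 n; lra.
Qed.

(** A series of polynomials, the [k]-th of which is at most [2 ^- k] on the
    [k]-th disc of the exhaustion. *)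
Section Sum.
Variable P : nat -> {poly C}.
Hypothesis hP : forall k z, modc z <= exhaust k -> modc (P k).[z] <= (1 / 2) ^+ k.

(** The sum at [z], with the same value for all the discs that contain [z]; for
    [z] outside of the unit disc the condition is void. *)
Lemma series_value z : exists l, forall n, modc z <= exhaust n ->
  modc (\sum_(k < n) (P k).[z] - l) <= 4 * (1 / 2) ^+ n.
Proof.
have [z1|z1] := ltP (modc z) 1; last first.
  exists 0 => n; have := exhaust_lt1 n; lra.
have exK : exists K, modc z <= exhaust K.
  by have [K /ltW] := exhaust_cofinal z1; exists K.
pose K := ex_minn exK.
have zK n : (K <= n)%N = (modc z <= exhaust n).
  apply/idP/idP; rewrite /K; case: ex_minnP => m hm mmin.
    by move=> mn; apply: le_trans hm (exhaust_le mn).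
  by move=> /mmin.
have [|l hl] := @complex_series (fun k => (P k).[z]) K 1.
  by move=> k; rewrite zK mul1r; exact: hP.
by exists l => n; rewrite -zK => /hl; rewrite mulr1.
Qed.

(** The sum inherits the Taylor estimates of its terms, which are dominated by a
    geometric series on any disc of the exhaustion. *)
Lemma series_taylor (f : C -> C) :
  (forall z n, modc z <= exhaust n ->
     modc (\sum_(k < n) (P k).[z] - f z) <= 4 * (1 / 2) ^+ n) ->
  forall w, modc w < 1 -> exists r k l, [/\ modc w < r, 0 < k &
    forall z, modc z <= r -> modc (f z - f w - (z - w) * l) <= k * modc (z - w) ^+ 2].
Proof.
move=> hf w w1; have [K hK] := exhaust_cofinal w1.
pose rho := exhaust K; pose r := (modc w + rho) / 2.
have w0 := modc_ge0 w; have rho1 := exhaust_lt1 K.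
have rr : 0 <= r < rho by rewrite /r /rho; apply/andP; split; lra.
have wr : modc w < r by rewrite /r /rho; lra.
have [k k0 hk] := taylor2 rr.
have /choice[M hM] : forall j, exists M : R, 0 < M /\
    forall z, modc z <= 1 -> modc (P j).[z] <= M.
  by move=> j; have [M] := poly_bounded (P j); exists M.
pose A : R := 1 + \sum_(j < K) M j * 2 ^+ j.
have MA (i : 'I_K) : 0 <= M i * 2 ^+ i.
  by rewrite mulr_ge0 ?exprn_ge0 // ltW // (hM i).1.
have A1 : 1 <= A by rewrite lerDl sumr_ge0.
have hA j z : modc z <= rho -> modc (P j).[z] <= A * (1 / 2) ^+ j.
  move=> zr; have [Kj|jK] := leqP K j.
    rewrite -[leLHS]mul1r ler_pM ?modc_ge0 //.
    by apply: hP; apply: le_trans zr (exhaust_le Kj).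
  rewrite div1r exprVn ler_pdivlMr ?exprn_gt0 //.
  apply: le_trans (_ : M j * 2 ^+ j <= _).
    by rewrite ler_wpM2r ?exprn_ge0 // (hM j).2 //; rewrite /rho in zr; lra.
  rewrite /A (bigD1 (Ordinal jK)) //= [1 + _]addrC -addrA lerDl.
  by rewrite addr_ge0 // sumr_ge0.
have /choice[c hc] : forall j, exists c, modc c <= k * (A * (1 / 2) ^+ j) /\
    forall z, modc z <= r -> modc ((P j).[z] - (P j).[w] - (z - w) * c) <=
      k * (A * (1 / 2) ^+ j) * modc (z - w) ^+ 2.
  by move=> j; have [c] := hk (P j) _ (hA j) w (ltW wr); exists c.
have [|l hl] := @complex_series c 0 (k * A).
  by move=> j _; have [+ _] := hc j; rewrite mulrA.
have sumA n : \sum_(j < n) A * (1 / 2) ^+ j <= 2 * A.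
  rewrite -mulr_sumr mulrC ler_wpM2r //; first lra.
  have := subrX1 (1 / 2 : R) n; have := half_exp_gt0 n; lra.
exists r, (k * (2 * A)), l; split => //.
  by rewrite !mulr_gt0 //; lra.
move=> z zr; set d := modc (z - w).
have zw2 : d <= 2 by have := modcB z w; rewrite -/d /rho in rr *; case/andP: rr; lra.
have d0 : 0 <= d := modc_ge0 _.
(* The estimate for the n-th partial sum holds up to B * (1 / 2) ^+ n. *)
apply/ler_addgt0Pr => e e0.
pose B := 8 + 8 * (k * A).
have B0 : 0 < B by rewrite ltr_pwDr // ?mulr_gt0 //; lra.
have [n0 hn0] := @half_exp_small (e / B) ltac:(by rewrite divr_gt0).
pose n := maxn n0 K.
have hn : B * (1 / 2) ^+ n <= e.
  rewrite mulrC -ler_pdivlMr //; apply: le_trans hn0.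
  by rewrite ler_wiXn2l ?leq_maxl //; lra.
have rn : rho <= exhaust n by rewrite exhaust_le // leq_maxr.
case/andP: rr => r0 r1.
have fz := hf z n ltac:(lra); have fw := hf w n ltac:(lra).
have ln := hl n isT.
pose Sz := \sum_(j < n) (P j).[z]; pose Sw := \sum_(j < n) (P j).[w].
pose Sc := \sum_(j < n) c j.
have main : modc (Sz - Sw - (z - w) * Sc) <= k * (2 * A) * d ^+ 2.
  rewrite /Sz /Sw /Sc mulr_sumr -!sumrB; apply: le_trans (modc_sum _ _ _) _.
  apply: le_trans (_ : \sum_(j < n) k * (A * (1 / 2) ^+ j) * d ^+ 2 <= _).
    by apply: ler_sum => j _; have [_] := hc j; apply.
  by rewrite -mulr_suml -mulr_sumr ler_wpM2r ?exprn_ge0 // ler_wpM2l ?(ltW k0).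
have -> : f z - f w - (z - w) * l = (Sz - Sw - (z - w) * Sc) +
   (- (Sz - f z) + ((Sw - f w) + (z - w) * (Sc - l))) by ring.
apply: le_trans (modcD _ _) _; apply: lerD => //.
apply: le_trans (modcD _ _) _; rewrite modcN.
have h1 := modcD (Sw - f w) ((z - w) * (Sc - l)); rewrite modcM -/d in h1.
have h2 : d * modc (Sc - l) <= 2 * (4 * (k * A) * (1 / 2) ^+ n).
  by apply: ler_pM => //; exact: modc_ge0.
apply: le_trans hn; rewrite /B -/Sz -/Sw -/Sc in fz fw ln *.
lra.
Qed.

End Sum.
End Series.

(** * Construction of the universal function *)

Section Construction.
Variable R : realType.
Local Notation C := R[i].
Implicit Types (z w : C).

(** A unit vector in the direction of a Gaussian rational, and [1] by convention
    for the direction of [0]. *)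
Definition rat_direction (c : rat * rat) : C :=
  let g := gauss_rat R c in if g == 0 then 1 else g / (modc g)%:C%C.

Lemma rat_direction1 c : modc (rat_direction c) = 1.
Proof.
rewrite /rat_direction; case: eqVneq => [_|g0]; first exact: modc1.
by rewrite modcM modcV (modc_pos (modc_ge0 _)) divff // modc_eq0.
Qed.

Lemma rat_direction_dense w (d : R) : modc w = 1 -> 0 < d ->
  exists c, modc (rat_direction c - w) <= d.
Proof.
move=> w1 d0; pose e := Num.min (1 / 2) (d / 2).
have e0 : 0 < e by rewrite lt_min; apply/andP; split; lra.
have e1 : e <= 1 / 2 by rewrite ge_min lexx.
have e2 : e <= d / 2 by rewrite ge_min lexx orbT.
have [c hc] := gauss_rat_dense w e0; exists c; rewrite /rat_direction.
set g := gauss_rat R c in hc *.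
have h1 := modc_subr w g; have h2 := modc_subr g w; rewrite w1 in h1 h2.
rewrite modcBC in h1.
have g0 : g != 0 by rewrite -modc_gt0; lra.
rewrite (negPf g0); apply: le_trans (modc_tri _ g _) _.
have gm : (modc g)%:C%C != 0 :> C by rewrite -modc_gt0 modc_pos ?modc_gt0 ?modc_ge0.
have -> : g / (modc g)%:C%C - g = g / (modc g)%:C%C * (1 - (modc g)%:C%C).
  by rewrite mulrBr mulr1 divfK.
have -> : 1 - (modc g)%:C%C = (1 - modc g)%:C%C :> C by rewrite rmorphB rmorph1.
rewrite !modcM modcV (modc_pos (modc_ge0 _)) divff ?modc_eq0 // mul1r modc_real.
by have : `|1 - modc g| <= e by [rewrite ler_norml; apply/andP; split; lra]; lra.
Qed.

Lemma arc_shrink w w' (eta d : R) : modc (w' - w) <= d ->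
  arc w eta `<=` arc w' (eta - d).
Proof. by move=> h z [z1 zw]; split=> //; have := modc_tri z w' w; lra. Qed.

Variable r : nat -> nat -> R.
Hypothesis r01 : forall l n, 0 < r l n < 1.
Hypothesis rinc : forall l m n, (m < n)%N -> r l m < r l n.
Hypothesis rcvg : forall l, r l @ \oo --> (1 : R).
Hypothesis rdisj : forall l l', l <> l' -> range (r l) `&` range (r l') = set0.

Lemma radii_inj (a b : nat * nat) : r a.1 a.2 = r b.1 b.2 -> a = b.
Proof.
case: a b => [l m] [l' m'] /= e.
have [ll'|/eqP ll'] := eqVneq l l'; last first.
  have : (range (r l) `&` range (r l')) (r l m) by split; [exists m|exists m'].
  by rewrite rdisj.
rewrite -ll' in e *; congr pair.
by case: (ltngtP m m') => // /rinc-/(_ l); rewrite e ltxx.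
Qed.

Lemma radii_eventually l (x : R) : x < 1 ->
  exists N, forall n, (N <= n)%N -> x < r l n.
Proof.
by move=> x1; have [N _ hN] := cvgr_gt _ (rcvg l) x x1; exists N.
Qed.

(** The radii handled at the [k]-th step of the construction. *)
Lemma finite_radii k : exists2 A : seq (nat * nat), uniq A &
  forall l n, ((l, n) \in A) =
    [&& (l <= k)%N, exhaust R k < r l n & r l n <= exhaust R k.+1].
Proof.
have /choice[N hN] : forall l, exists N, forall n, (N <= n)%N -> exhaust R k.+1 < r l n.
  by move=> l; apply: radii_eventually; exact: exhaust_lt1.
pose M := \max_(l < k.+1) N l.
exists [seq a <- [seq (l, n) | l <- iota 0 k.+1, n <- iota 0 M] |
    (exhaust R k < r a.1 a.2) && (r a.1 a.2 <= exhaust R k.+1)].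
  by rewrite filter_uniq // allpairs_uniq ?iota_uniq // => -[? ?] [? ?].
move=> l n; rewrite mem_filter andbC.
apply/andP/and3P => [[/allpairsP[[l' n'] [hl hn [-> ->]]] /andP[h1 h2]]|[lk h1 h2]].
  by move: hl; rewrite mem_iota add0n ltnS => /andP[_ ?]; split.
split; last exact/andP.
apply: allpairs_f; first by rewrite mem_iota.
rewrite mem_iota /= add0n; apply: leq_trans (leq_bigmax (Ordinal (lk : (l < k.+1)%N))).
by rewrite ltnNge; apply/negP => /hN /=; rewrite ltNge h2.
Qed.

(** The data of a target: a polynomial with Gaussian rational coefficients, the
    direction of the omitted point of an arc, and an integer [e] for the radius
    [1 / (e + 1)] of the omitted disc. *)
Definition datum := (seq (rat * rat) * (rat * rat) * nat)%type.

(** The target assigned to the [n]-th radius of each sequence is encoded by the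
    2-adic valuation of [n], so that any target is assigned along an arithmetic
    progression. An arbitrary one is taken when the valuation is not a code. *)
Definition datum_of n : datum := odflt ([::], (0, 0), 0%N) (choice.unpickle (logn 2 n)).

(** The arc on which the target is to be approximated. *)
Definition datum_arc (D : datum) : set C :=
  arc (rat_direction D.1.2) (D.2.+1%:R^-1).

(** The task at the radius [r a.1 a.2], when the sum [S] of the preceding
    polynomials has to be corrected: the target polynomial is rescaled so that
    its values are those on the arc of radius [1]. *)
Definition task_of (S : {poly C}) (a : nat * nat) : task R :=
  let D := datum_of a.2 in
  Task (r a.1 a.2) (rat_direction D.1.2) (D.2.+1%:R^-1)
    (rat_poly R D.1.1 \Po ((r a.1 a.2)^-1%:C%C *: 'X) - S).

Lemma stage k (S : {poly C}) : exists P : {poly C},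
  (forall z, modc z <= exhaust R k -> modc P.[z] <= (1 / 2) ^+ k) /\
  forall l n, (l <= k)%N -> exhaust R k < r l n -> r l n <= exhaust R k.+1 ->
    fulfils P ((1 / 2) ^+ k) (task_of S (l, n)).
Proof.
have [A uA hA] := finite_radii k.
have [|||P [P0 P1]] := @runge_arcs R _ A (task_of S) _ _
  (exhaust_gt0 R k) (half_exp_gt0 R k).
- move=> [l n] _; split => /=; first exact: rat_direction1.
    by rewrite invr_gt0.
  by have /andP[_ /ltW] := r01 l n.
- by move=> [l n]; rewrite hA => /and3P[].
- by rewrite map_inj_uniq //; exact: radii_inj.
exists P; split=> // l n lk h1 h2; apply: P1.
by rewrite hA lk h1 h2.
Qed.

(** The sum of the series of polynomials given by [stage]. It has second order
    Taylor expansions in the unit disc, and it approximates each target at all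
    the large enough indices of a given 2-adic valuation. *)
Lemma universal_function : exists f : C -> C,
  (forall w, modc w < 1 -> exists rho k l, [/\ modc w < rho, 0 < k &
    forall z, modc z <= rho ->
      modc (f z - f w - (z - w) * l) <= k * modc (z - w) ^+ 2]) /\
  forall l (D : datum) (eps : R), 0 < eps ->
    exists q N, forall n, (N <= n)%N -> logn 2 n = q ->
    forall z, datum_arc D z ->
      modc (f ((r l n)%:C%C * z) - (rat_poly R D.1.1).[z]) <= eps.
Proof.
have /choice[st hst] : forall kS : nat * {poly C}, exists P : {poly C},
  (forall z, modc z <= exhaust R kS.1 -> modc P.[z] <= (1 / 2) ^+ kS.1) /\
  forall l n, (l <= kS.1)%N -> exhaust R kS.1 < r l n -> r l n <= exhaust R kS.1.+1 ->
    fulfils P ((1 / 2) ^+ kS.1) (task_of kS.2 (l, n)).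
  by move=> [k S]; exact: stage.
pose S := fix S k := if k is j.+1 then S j + st (j, S j) else 0.
pose P k := st (k, S k).
have SE k z : (S k).[z] = \sum_(j < k) (P j).[z].
  elim: k => [|k IH]; first by rewrite big_ord0 horner0.
  by rewrite big_ord_recr /= hornerD IH.
have hP k z : modc z <= exhaust R k -> modc (P k).[z] <= (1 / 2) ^+ k.
  by have [h _] := hst (k, S k); exact: h.
have /choice[f hf] := series_value hP.
exists f; split; first exact: (@series_taylor _ _ hP f hf).
move=> l D eps eps0; exists (choice.pickle D).
have [k1 hk1] := @half_exp_small R (eps / 3) ltac:(lra).
pose k0 := maxn l k1.
have [N hN] := radii_eventually l (exhaust_lt1 R k0).
exists N => n /hN rn nq z Dz; have /andP[rn0 rn1] := r01 l n.
(* The step k of the construction at which the radius r l n is handled. *)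
have exk : exists k, r l n <= exhaust R k.+1.
  have [k hk] := exhaust_cofinal rn1; exists k; apply: le_trans (ltW hk) _.
  exact: exhaust_le.
pose k := ex_minn exk.
have rk : r l n <= exhaust R k.+1 by rewrite /k; case: ex_minnP.
have k0k : (k0 <= k)%N.
  rewrite leqNgt; apply/negP => kk0; have := exhaust_le R kk0.
  by move=> h; have := le_trans rk h; rewrite leNgt rn.
have kr : exhaust R k < r l n.
  rewrite ltNge; apply/negP => h.
  have k_gt0 : (0 < k)%N.
    rewrite lt0n; apply/eqP => kz; rewrite kz in h k0k.
    by move: rn; rewrite ltNge (le_trans h) // exhaust_le.
  rewrite -(prednK k_gt0) in h; move: (h); rewrite leNgt => /negP; apply.
  rewrite ltNge; apply/negP => h'.
  have : (k <= k.-1)%N by rewrite {1}/k; case: ex_minnP => m _; apply.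
  by rewrite leqNgt ltn_predL k_gt0.
have lk : (l <= k)%N by apply: leq_trans k0k; exact: leq_maxl.
have k1k : (k1 <= k)%N by apply: leq_trans k0k; exact: leq_maxr.
have datE : datum_of n = D by rewrite /datum_of nq choice.pickleK.
have [_ hful] := hst (k, S k); have := hful l n lk kr rk z.
rewrite /= datE => /(_ Dz); set y := _ * z.
rewrite hornerD hornerN horner_comp hornerZ hornerX /y mulrA -rmorphM /=.
rewrite mulVf ?gt_eqF // rmorph1 [1 * z]mul1r -/y => h1.
have yk : modc y <= exhaust R k.+1.
  by rewrite modcM modc_pos ?(ltW rn0) //; case: Dz => -> _; rewrite mulr1.
have h2 := hf y k.+1 yk; rewrite -SE /= hornerD exprS in h2.
have h3 : (1 / 2) ^+ k <= eps / 3.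
  by apply: le_trans hk1; rewrite ler_wiXn2l //; lra.
rewrite modcBC in h2.
apply: le_trans (modc_tri _ ((S k).[y] + (st (k, S k)).[y]) _) _.
have -> : (S k).[y] + (st (k, S k)).[y] - (rat_poly R D.1.1).[z] =
  (st (k, S k)).[y] - ((rat_poly R D.1.1).[z] - (S k).[y]) by ring.
lra.
Qed.

End Construction.

(** * Lower density of arithmetic progressions *)

Section Density.
Variable R : realType.

Lemma le_limn_einf (u : (\bar R)^nat) (c : \bar R) N :
  (forall n, (N <= n)%N -> (c <= u n)%E) -> (c <= limn_einf u)%E.
Proof.
move=> h; rewrite limn_einf_lim (cvg_lim _ (cvg_einfs_sup (u := u))) //.
apply: le_trans (_ : (einfs u N <= _)%E); last by apply: ereal_sup_ubound; exists N.
by apply: le_ereal_inf_tmp => _ [n Nn <-]; exact: h.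
Qed.

(** A set that contains an arithmetic progression has positive lower density. *)
Lemma lower_density_progression (E : set nat) a b : (0 < a)%N -> (0 < b)%N ->
  (forall j, E (b + a * j)%N) -> (0 < lower_density R E)%E.
Proof.
move=> a0 b0 hE.
(* Half of the density of the progression leaves room for its first terms. *)
suff : (((2 * a)%:R^-1 : R)%:E <= lower_density R E)%E.
  by apply: lt_le_trans; rewrite lte_fin invr_gt0 ltr0n muln_gt0.
apply: (@le_limn_einf _ _ (2 * (a + b))%N) => n hn; rewrite lee_fin.
set X := E `&` _.
have finX : finite_set X.
  apply: (@sub_finite_set _ _ `I_n.+1); last exact: finite_II.
  by move=> k [_ /= /andP[_ ?]]; rewrite ltnS.
pose m := ((n - b) %/ a)%N.
have dm := divn_eq (n - b) a; have rm := ltn_pmod (n - b) a0; rewrite -/m in dm.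
pose s := [seq (b + a * j)%N | j <- iota 0 m].
have us : uniq s.
  rewrite map_inj_uniq ?iota_uniq // => i j ij.
  by apply/eqP; rewrite -(eqn_pmul2l a0) -(eqn_add2l b) ij.
have sX : {subset s <= fset_set X}.
  move=> x /mapP[j]; rewrite mem_iota add0n => /andP[_ jm] ->.
  rewrite in_fset_set //; apply/mem_set; split; first exact: hE.
  rewrite /= addn_gt0 b0 /=; have : (a * j <= m * a)%N by rewrite mulnC leq_pmul2r // ltnW.
  lia.
have mX : (m <= #|` fset_set X|)%N.
  by have := uniq_leq_size us sX; rewrite size_map size_iota.
have n0 : (0 < n)%N by lia.
rewrite ler_pdivlMr ?ltr0n // mulrC ler_pdivrMr ?ltr0n ?muln_gt0 //.
rewrite -natrM ler_nat; apply: leq_trans (leq_mul mX (leqnn _)).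
nia.
Qed.

Lemma logn2_progression q N j : logn 2 (2 ^ q * (2 * N + 1) + 2 ^ q.+1 * j) = q.
Proof.
have -> : (2 ^ q * (2 * N + 1) + 2 ^ q.+1 * j = 2 ^ q * (2 * (N + j)).+1)%N.
  by rewrite expnS; ring.
rewrite lognM ?expn_gt0 // pfactorK // logn_coprime ?addn0 //.
by rewrite coprime2n /= mul2n odd_double.
Qed.

End Density.

(** * Topology of the plane and of spaces of continuous functions *)

Section Topology.
Variable R : realType.
Local Notation C := (Cplx R).
Implicit Types (w z : C) (K : set C).

(** Neighbourhoods in terms of the real-valued modulus. *)
Lemma nbhs_modcP w (A : set C) :
  nbhs w A <-> exists2 e : R, 0 < e & forall z, modc (z - w) <= e -> A z.
Proof.
split=> [/nbhs_normP[e /= e0 hA]|[e e0 hA]].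
  have [Ree eE] : 0 < complex.Re e /\ e = (complex.Re e)%:C%C.
    by move: e0; rewrite ltcE /= => /andP[/eqP i0 ->]; rewrite {1}(complexE e) i0 mulr0 addr0.
  exists (complex.Re e / 2) => [|z zw]; first by rewrite divr_gt0.
  apply: hA; rewrite /= normE eE ltcR modcBC.
  by apply: le_lt_trans zw _; lra.
apply/(@nbhs_normP _ C); exists (e%:C)%C => /=; first by rewrite ltcR.
by move=> z /=; rewrite normE ltcR modcBC => /ltW; exact: hA.
Qed.

Lemma closed_modc K : closed K -> forall w, ~ K w ->
  exists2 e : R, 0 < e & forall z, K z -> e <= modc (z - w).
Proof.
move=> clK w Kw; have : nbhs w (~` K).
  by apply: open_nbhs_nbhs; split=> //; exact: closed_openC.
move=> /nbhs_modcP[e e0 he]; exists e => // z Kz.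
by have [//|/ltW/he] := leP e (modc (z - w)).
Qed.

Lemma compact_net K (d : R) : compact K -> 0 < d ->
  exists2 S : seq C, {in S, forall y, K y} &
    forall z, K z -> exists2 y, y \in S & modc (z - y) <= d.
Proof.
rewrite compact_cover => cK d0.
pose U (y : C) : set C := interior [set z : C | modc (z - y) <= d].
have [|z Kz|D DK hD] := cK C K U.
- by move=> y _; exact: open_interior.
- by exists z => //; apply/nbhs_modcP; exists d.
exists D => [y /DK|z /hD[y /= yD]]; first by rewrite inE.
by move=> /interior_subset ?; exists y.
Qed.

(** A function continuous along a compact set is uniformly continuous on it. *)
Lemma compact_modulus K (g : C -> C) : compact K ->
  (forall w, K w -> forall eps : R, 0 < eps -> exists2 d : R, 0 < d &
     forall z, K z -> modc (z - w) <= d -> modc (g w - g z) <= eps) ->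
  forall eps : R, 0 < eps -> exists2 d : R, 0 < d &
    forall y z, K y -> K z -> modc (z - y) <= d -> modc (g y - g z) <= eps.
Proof.
move=> /compact_near_coveringP cK hg eps e0.
pose P (d : R) y := forall z, K y -> K z -> modc (z - y) <= d -> modc (g y - g z) <= eps.
have := cK R (0 : R)^'+ P _ _; case.
  move=> x Kx; have [d d0 hd] := hg x Kx (eps / 2) ltac:(lra).
  exists ([set y | modc (y - x) <= d / 2], [set t : R | t < d / 2]) => /=.
    split; first by apply/nbhs_modcP; exists (d / 2) => //; lra.
    by apply: nbhs_right_lt; lra.
  move=> [y t] /= [yx td] z Ky Kz zy.
  have h1 := hd y Ky ltac:(lra); have h2 := modc_tri z y x.
  have h3 := hd z Kz ltac:(lra).
  by apply: le_trans (modc_tri _ (g x) _) _; rewrite modcBC; lra.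
move=> d /= d0 hd.
exists (d / 2) => [|y z Ky Kz zy]; first lra.
have := hd (d / 2); rewrite /ball_ /=.
have dd : `|0 - d / 2| < d by rewrite sub0r normrN gtr0_norm; lra.
by move=> /(_ dd ltac:(lra) y Ky); apply.
Qed.

(** The open sets of [C(K)] are open for the uniform norm. *)
Lemma open_uniform K (V : set (Cont K)) (g : continuousType (set_type K) C) :
  open V -> V g -> exists2 e : R, 0 < e &
    forall g' : continuousType (set_type K) C,
      (forall t, modc (g t - g' t) <= e) -> V g'.
Proof.
move=> oV Vg; have : nbhs (g : Cont K) V by apply: open_nbhs_nbhs.
rewrite -nbhs_entourageE => -[A [A' [E entE sE] sA] sV].
move: entE; rewrite -entourage_ballE => -[e /= e0 he].
have : nbhs (0 : C) [set z | `|z| < e].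
  by apply/(@nbhs_normP _ C); exists e => // z /=; rewrite sub0r normrN.
move=> /nbhs_modcP[d d0 hd]; exists d => // g' hg'.
apply: sV; apply/xsectionP; apply: sA; apply: sE => t /=; apply: he => /=.
by apply: hd; rewrite subr0.
Qed.

Lemma derivable_taylor (f : C -> C) w (rho k : R) (l : C) : modc w < rho -> 0 < k ->
  (forall z, modc z <= rho ->
     modc (f z - f w - (z - w) * l) <= k * modc (z - w) ^+ 2) ->
  derivable f w 1.
Proof.
move=> wr k0 hf; apply/cvg_ex; exists l => A /nbhs_modcP[e e0 hA].
apply/nbhs_modcP; exists (Num.min (rho - modc w) (e / k)).
  by rewrite lt_min subr_gt0 wr divr_gt0.
move=> h; rewrite subr0 le_min => /andP[h1 h2] h0; apply: hA => /=.
have -> : h *: (1 : C) + w = w + h by rewrite addrC; congr (_ + _); exact: mulr1.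
have wh : modc (w + h) <= rho by have := modcD w h; lra.
have := hf _ wh; have -> : w + h - w = h by rewrite addrC addKr.
have -> : h^-1 *: (f (w + h) - f w) - l = h^-1 * (f (w + h) - f w - h * l).
  by rewrite mulrBr mulKf.
rewrite modcM modcV => hh.
have mh : 0 < modc h by rewrite modc_gt0.
rewrite mulrC ler_pdivrMr //; apply: le_trans hh _.
rewrite expr2 mulrA ler_pM2r // mulrC -ler_pdivlMr //.
Qed.

Lemma continuous_taylor (f : C -> C) w (rho k : R) (l : C) : modc w < rho -> 0 < k ->
  (forall z, modc z <= rho ->
     modc (f z - f w - (z - w) * l) <= k * modc (z - w) ^+ 2) ->
  {for w, continuous f}.
Proof.
move=> wr k0 hf A /nbhs_modcP[e e0 hA]; apply/nbhs_modcP.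
pose M := modc l + k; have M0 : 0 < M by rewrite ltr_wpDl ?modc_ge0.
exists (Num.min (rho - modc w) (Num.min 1 (e / M))).
  by rewrite !lt_min subr_gt0 wr ltr01 divr_gt0.
move=> z; rewrite !le_min => /and3P[h1 h2 h3]; apply: hA.
have zr : modc z <= rho by have := modc_subr z w; lra.
have := hf z zr; set d := modc (z - w) in h1 h2 h3 * => h4.
have d0 : 0 <= d := modc_ge0 _.
have h5 := modcD (f z - f w - (z - w) * l) ((z - w) * l).
rewrite subrK modcM -/d in h5; rewrite ler_pdivlMr // in h3.
have h6 : k * d ^+ 2 <= k * d by rewrite ler_pM2l // expr2 ler_piMr.
move: h3; rewrite /M; lra.
Qed.

(** On a proper compact part of the circle, any continuous function is
    uniformly close to a polynomial with Gaussian rational coefficients, and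
    the compact set lies in an arc with rational data. *)
Lemma datum_dense K (g : continuousType (set_type K) C) (eps : R) :
  proper_compact K -> 0 < eps -> exists D : datum, K `<=` datum_arc D /\
    forall t : set_type K, modc (g t - (rat_poly R D.1.1).[(\val t)]) <= eps.
Proof.
move=> [cK KT KnT] e0.
have clK : closed K by apply: compact_closed => //; exact: norm_hausdorff.
have K1 z : K z -> modc z = 1 by move=> /KT; rewrite /unit_circle /= normE => /complexI.
have [w [w1 Kw]] : exists w, modc w = 1 /\ ~ K w.
  apply/not_existsP => h; apply: KnT; rewrite eqEsubset; split=> // w.
  rewrite /unit_circle /= normE => /complexI w1.
  by have [//|Kw] := pselect (K w); case: (h w).
have [eta eta0 heta] := closed_modc clK Kw.
have Karc : K `<=` arc w eta by move=> z Kz; split; [exact: K1|exact: heta].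
(* G extends g by 0 outside of K. *)
pose G (z : C) : C := if pselect (K z) is left Kz then g (exist _ z (mem_set Kz)) else 0.
have GE (t : set_type K) : G (\val t) = g t.
  rewrite /G; case: pselect => [Kt|]; last by case; exact: set_valP.
  by congr (g _); exact: val_inj.
have hG w' : K w' -> forall e : R, 0 < e -> exists2 d : R, 0 < d &
     forall z, K z -> modc (z - w') <= d -> modc (G w' - G z) <= e.
  move=> Kw' e e0'; pose t : set_type K := exist _ w' (mem_set Kw').
  have := @cts_fun _ _ g t [set z : C | modc (z - g t) <= e].
  case; first by apply/nbhs_modcP; exists e.
  move=> U [[U' oU' <-] /= U't sU].
  have /nbhs_modcP[d d0 hd] : nbhs w' U' by apply: open_nbhs_nbhs.
  exists d => // z Kz /hd U'z.
  have := sU (exist _ z (mem_set Kz)) U'z.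
  by rewrite /= -(GE t) -GE /= modcBC.
have aG : appr K G.
  apply: (appr_continuous w1 eta0 Karc); first exact: compact_modulus.
  by move=> d; exact: compact_net.
have [p hp] := aG (eps / 2) ltac:(lra).
have [s hs] := rat_poly_dense p (ltac:(lra) : 0 < eps / 2).
have [c hc] := @rat_direction_dense R w (eta / 2) w1 ltac:(lra).
have [e he] : exists e : nat, e.+1%:R^-1 <= eta / 2.
  exists (Num.bound (2 / eta)).
  have h0 : 0 < 2 / eta by rewrite divr_gt0.
  rewrite -[leRHS]invrK lef_pV2 ?posrE ?invr_gt0 ?divr_gt0 // invf_div.
  by apply: le_trans (ltW (archi_boundP (ltW h0))) _; rewrite ler_nat.
exists (s, c, e); split=> [z Kz|t] /=.
  have [z1 zc] := arc_shrink hc (Karc z Kz); split=> //.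
  by apply: le_trans he _; apply: le_trans zc; lra.
have Kt : K (\val t) by exact: set_valP.
rewrite -GE; apply: le_trans (modc_tri _ p.[(\val t)] _) _.
have h1 := hp _ Kt; have h2 := hs (\val t) ltac:(by rewrite K1).
by rewrite modcBC in h1; rewrite modcBC in h2; lra.
Qed.

End Topology.

(** * The theorem *)

Theorem proposition6p12 (R : realType)
    (B : forall K : set (Cplx R), set (set (Cont K)))
    (hB : countable_bases B)
    (r : nat -> nat -> R)
    (r01 : forall l n, 0 < r l n < 1)
    (rinc : forall l m n, (m < n)%N -> r l m < r l n)
    (rcvg : forall l, r l @ \oo --> (1 : R))
    (rdisj : forall l l', l <> l' -> range (r l) `&` range (r l') = set0) :
  \bigcap_(l in [set: nat]) FUA B (r l) !=set0.
Proof.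
have [f [ftaylor funiv]] := universal_function r01 rinc rcvg rdisj.
exists f => l _; split=> [w|K hK V BV [g Vg]].
  rewrite /unit_disc /= normE ltcR => /ftaylor[rho [k [c [wr k0 hf]]]].
  exact: derivable_taylor wr k0 hf.
have [e e0 he] := open_uniform ((hB K hK).2.1 V BV) Vg.
have [D [KD hD]] := datum_dense g hK (ltac:(lra) : 0 < e / 2).
have [q [N hN]] := funiv l D (e / 2) ltac:(lra).
apply: (@lower_density_progression _ _ (2 ^ q.+1) (2 ^ q * (2 * N + 1))).
- by rewrite expn_gt0.
- by rewrite muln_gt0 expn_gt0 addn1.
move=> j; set n := (_ + _)%N.
have nq : logn 2 n = q by exact: logn2_progression.
have Nn : (N <= n)%N.
  have : (0 < 2 ^ q)%N by rewrite expn_gt0.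
  by rewrite /n; nia.
have KT z : K z -> modc z = 1.
  by case: hK => _ KT _ /KT; rewrite /unit_circle /= normE => /complexI.
pose h (t : set_type K) : Cplx R := f ((r l n)%:C%C * \val t).
have hc : continuous h.
  move=> t; have tK : K (\val t) by exact: set_valP.
  have /ftaylor[rho [k [c [wr k0 hf]]]] : modc ((r l n)%:C%C * \val t) < 1.
    have /andP[h0 h1] := r01 l n.
    by rewrite modcM modc_pos ?(ltW h0) // KT // mulr1.
  pose m (z : Cplx R) : Cplx R := (r l n)%:C%C * z.
  have cval : {for t, continuous (set_val : set_type K -> Cplx R)}.
    exact: initial_continuous.
  have cm : {for set_val t, continuous m} by exact: mulrl_continuous.
  have cf : {for m (set_val t), continuous (f : Cplx R -> Cplx R)}
    by exact: continuous_taylor wr k0 hf.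
  exact: (continuous_comp cval (continuous_comp cm cf)).
exists (mkcts hc : continuousType _ _) => //.
apply: he => t; have tK : K (\val t) by exact: set_valP.
apply: le_trans (modc_tri _ (rat_poly R D.1.1).[(\val t)] _) _.
rewrite [e]splitr; apply: lerD; first exact: hD.
by rewrite modcBC; exact: hN n Nn nq _ (KD _ tK).
Qed.
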